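(* Let $\lambda$ be a partition and write $Q_\lambda(\alpha)=\sum_{\mu\ge\lambda}C_{\lambda\mu}(\alpha)q_\mu(\alpha)$. Then for every $\mu>\lambda$, $$C_{\lambda\mu}(\alpha)=\frac{\sum_{\nu\in M_*(\mu),\ \nu\ge\lambda}C_{\lambda\nu}(\alpha)r_{\nu\mu}}{e'_\lambda(\alpha)-e'_\mu(\alpha)}.$$
   Context: $F=\mathbb{Q}(\alpha)$, $\Lambda_F=F[p_1,p_2,\dots]$ ($p_n$ power sums). For a partition $\lambda$: $l(\lambda)$ number of parts, $m_a(\lambda)$ number of parts equal to $a$, $z_\lambda=\prod_ii^{m_i(\lambda)}m_i(\lambda)!$. Dominance order $\ge$ on partitions of equal weight. Scalar product $\langle p_\lambda,p_\mu\rangle=\delta_{\lambda\mu}\alpha^{l(\lambda)}z_\lambda$. Jack $P_\lambda(\alpha)$: the pairwise orthogonal functions of the form $m_\lambda+\sum_{\mu<\lambda}c_{\lambda\mu}m_\mu$ ($m_\mu$ monomials); $Q_\lambda=\langle P_\lambda,P_\lambda\rangle^{-1}P_\lambda$. $Q_n(\alpha)=\sum_{\lambda\vdash n}\alpha^{-l(\lambda)}z_\lambda^{-1}p_\lambda$ ($Q_0=1$), $q_\lambda=Q_{\lambda_1}Q_{\lambda_2}\cdots$. $e'_\lambda(\alpha)=\frac12\alpha\sum_i\lambda_i^2-\sum_ii\lambda_i$. Moving up operator: for $i<j$ and $0<k\le\lambda_j$, $r^i_j(k).\lambda$ is the rearrangement in decreasing order of $(\lambda_1,\dots,\lambda_i+k,\dots,\lambda_j-k,\dots)$;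 $M^*(\lambda)$ is the set of all such $r^i_j(k).\lambda$, and $M_*(\mu)=\{\nu:\mu\in M^*(\nu)\}$. For $\mu=r^i_j(k).\nu$, $r_{\nu\mu}=(1+\delta_{\nu_i\nu_j})^{-1}m_{\nu_i}(\nu)(m_{\nu_j}(\nu)-\delta_{\nu_i\nu_j})(\nu_i-\nu_j+2k)$. *)

(* Defs.v *)
From HB Require Import structures.
From mathcomp Require Import all_boot all_order all_algebra.
From mathcomp Require Import fraction.
From mathcomp Require Export mpoly.
Set Implicit Arguments. Unset Strict Implicit. Unset Printing Implicit Defensive.
Import Order.TTheory GRing.Theory Num.Theory.
Local Open Scope ring_scope.

Definition F : fieldType := {fraction {poly rat}}.
Definition alpha : F := tofrac ('X : {poly rat}).

Definition is_partition (s : seq nat) : bool :=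
  sorted geq s && all (fun x => 0 < x)%N s.
Definition is_part_of (n : nat) (s : seq nat) : bool :=
  is_partition s && (sumn s == n).

Fixpoint seqs_upto (len b : nat) : seq (seq nat) :=
  match len with
  | 0 => [:: [::]]
  | l.+1 => [::] :: [seq i :: s | i <- iota 1 b, s <- seqs_upto l b]
  end.

Definition enum_part (n : nat) : seq (seq nat) :=
  [seq s <- seqs_upto n n | is_part_of n s].

(* dominance order (for partitions of equal weight) *)
Definition dom_le (mu la : seq nat) : bool :=
  [forall k : 'I_(size mu + size la).+1,
     (sumn (take k mu) <= sumn (take k la))%N].
Definition dom_lt (mu la : seq nat) : bool := dom_le mu la && (mu != la).

Definition mult (a : nat) (la : seq nat) : nat := count_mem a la.

Definition eprime (la : seq nat) : F :=
  alpha / 2%:R * (\sum_(x <- la) (x ^ 2)%N%:R)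
  - \sum_(i < size la) (i.+1 * nth 0 la i)%N%:R.

(* moving up operator r^i_j(k).la, indices 0-based (i < j < size la) *)
Definition moveup (la : seq nat) (i j k : nat) : seq nat :=
  sort geq [seq x <- set_nth 0 (set_nth 0 la i (nth 0 la i + k)%N) j
                                  (nth 0 la j - k)%N | (0 < x)%N].

Definition valid_move (la : seq nat) (t : nat * nat * nat) : bool :=
  let: (i, j, k) := t in
  [&& (i < j)%N, (j < size la)%N, (0 < k)%N & (k <= nth 0 la j)%N].

Definition move_triples (la : seq nat) : seq (nat * nat * nat) :=
  [seq t <- flatten [seq [seq (i, j, k) | k <- iota 1 (sumn la)]
                            | i <- iota 0 (size la), j <- iota 0 (size la)] | valid_move la t].

Definition in_Mup (nu mu : seq nat) : bool :=
  has (fun t => let: (i, j, k) := t in moveup nu i j k == mu) (move_triples nu).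

(* r_{nu mu} for mu = r^i_j(k).nu (well defined; the first such triple is used) *)
Definition r_coef (nu mu : seq nat) : F :=
  let t := nth (0, 0, 0)%N
             [seq t <- move_triples nu | let: (i, j, k) := t in moveup nu i j k == mu] 0 in
  let: (i, j, k) := t in
  let a := nth 0 nu i in let b := nth 0 nu j in
  ((1 + (a == b)%N%:R)^-1) * (mult a nu)%:R * ((mult b nu)%:R - (a == b)%N%:R)
  * ((a%:R - b%:R) + (2 * k)%N%:R).

(* ---------- Lambda_F in degrees <= n: F[p_1, ..., p_n], variable i = p_{i+1} ---------- *)
Definition Lam (n : nat) := {mpoly F[n]}.

(* for a monomial m of the p's (m i = m_{i+1}(la)): weight |la|, z_la *)
Definition pweight n (m : 'X_{1..n}) : nat := (\sum_(i < n) i.+1 * m i)%N.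
Definition zee n (m : 'X_{1..n}) : F :=
  \prod_(i < n) ((i.+1 ^ m i) * (m i)`!)%N%:R.

(* <p_la, p_mu> = delta alpha^{l(la)} z_la ; note l(la) = mdeg m *)
Definition scal n (f g : Lam n) : F :=
  \sum_(m <- msupp f) f@_m * g@_m * alpha ^+ mdeg m * zee m.

Definition Qk n (k : nat) : Lam n :=
  \sum_(m : 'X_{1..n < k.+1} | pweight m == k)
      ((alpha ^- mdeg m) / zee m) *: 'X_[(m : 'X_{1..n})].

Definition qla n (la : seq nat) : Lam n := \prod_(x <- la) Qk n x.

Definition psum_x n : n.-tuple {mpoly F[n]} :=
  [tuple \sum_(j < n) 'X_j ^+ i.+1 | i < n].
Definition ev n (f : Lam n) : {mpoly F[n]} := comp_mpoly (psum_x n) f.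

Definition msymm n (mu : seq nat) : {mpoly F[n]} :=
  \sum_(m : 'X_{1..n < (sumn mu).+1}
          | sort geq [seq x <- [seq m i | i <- enum 'I_n] | (0 < x)%N] == mu)
      'X_[(m : 'X_{1..n})].

Definition jack_family n (P : seq nat -> Lam n) : Prop :=
  (forall la, la \in enum_part n ->
     exists c : seq nat -> F,
       ev (P la) = msymm n la
                   + \sum_(mu <- enum_part n | dom_lt mu la) c mu *: msymm n mu)
  /\ (forall la mu, la \in enum_part n -> mu \in enum_part n -> la != mu ->
        scal (P la) (P mu) = 0).

Definition QJ n (P : seq nat -> Lam n) (la : seq nat) : Lam n :=
  (scal (P la) (P la))^-1 *: P la.

(* Main.v *)
(** Let D be the Laplace-Beltrami operator, written in power sums.  The adjoint of
    multiplication by p_k is alpha k d/dp_k, so D is self-adjoint; and since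
    d/dp_k lowers Q_a to Q_{a-k} / (alpha k), a telescoping of the sums
    p_{k+l} Q_{a-k} Q_{b-l} gives, for nu a partition of n,
      D q_nu = (e'_nu + n/2) q_nu + sum over mu in M^*(nu) of r_{nu mu} q_mu.
    The q_mu are dual to the monomial functions, so <q_mu, P_la> = 0 unless
    mu <= la.  As D only moves mu up in the dominance order, D P_la is a
    combination of the P_eta with eta <= la, hence orthogonal to P_ka for every
    ka > la.  Therefore the combination (D - e'_la - n/2) Q_la of the q_mu with
    mu > la is orthogonal to all P_ka with ka > la, and by triangularity of
    <q_mu, P_ka> all its coefficients vanish: this is the recursion. *)

Require Import Defs.
From HB Require Import structures.
From mathcomp Require Import all_boot all_order all_algebra.
From mathcomp Require Import fraction ring zify.
From mathcomp Require Import mpoly.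
Import GRing.Theory.
Set Implicit Arguments. Unset Strict Implicit. Unset Printing Implicit Defensive.
Local Open Scope ring_scope.

(** * The scalar product and the Laplace-Beltrami operator *)

(** Two coordinate systems meet here: Jack functions are prescribed by monomials in $x_1,\dots,x_n$,
    whereas the scalar product and $D$ are written in $p_1,\dots,p_n$. The duality between $q_\mu$
    and monomials links them, and the algebraic independence of $p_1,\dots,p_n$ carries vanishing
    statements back. In weight $n$, $n$ variables suffice on both sides: a partition of $n$ has at
    most $n$ parts, each at most $n$. $D$ has order two, and its failure to obey the Leibniz rule is
    a biderivation; so $D q_\nu$ is determined by single factors $Q_a$, which are eigenfunctions,
    and by pairs. In the telescoping for a pair, $Q_{a+k}Q_{b-k}$ receives $a+k$ from one step and
    $-(b-k)$ from the next, whence the factor $\nu_i-\nu_j+2k$ of $r_{\nu\mu}$; its other factors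
    count the pairs of positions that lead to the same $\mu$. Dividing by $e'_\lambda-e'_\mu$ is
    legitimate because the two differ already in their part free of $\alpha$. *)

Lemma alpha_neq0 : alpha != 0.
Proof. by rewrite tofrac_eq0 polyX_eq0. Qed.

Lemma natF_eq0 (k : nat) : (k%:R == 0 :> F) = (k == 0)%N.
Proof.
rewrite -(rmorph_nat (@tofrac {poly rat})) tofrac_eq0 -polyC_natr polyC_eq0.
by rewrite Num.Theory.pnatr_eq0.
Qed.

Section Scal.
Variable n : nat.
Implicit Types (f g : Lam n) (m : 'X_{1..n}).

(** The squared norm of the product of power sums with exponents [m]. *)
Definition mwt m : F := alpha ^+ mdeg m * zee m.

Lemma zee_neq0 m : zee m != 0.
Proof.
apply/prodf_neq0 => i _; rewrite natF_eq0 muln_eq0 negb_or expn_eq0 /=.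
by rewrite -lt0n fact_gt0.
Qed.

Lemma mwt0 : mwt 0 = 1.
Proof.
rewrite /mwt mdeg0 expr0 mul1r /zee big1 // => i _.
by rewrite mnm0E expn0 fact0.
Qed.

(** This ratio of squared norms is the whole content of adjointness between multiplication by a
    variable and its derivative. *)
Lemma mwtDU m i : mwt (m + U_(i)) = alpha * i.+1%:R * (m i).+1%:R * mwt m.
Proof.
rewrite /mwt mdegD mdeg1 addn1 exprS /zee (bigD1 i) //= [in RHS](bigD1 i) //=.
have -> : \prod_(j < n | j != i) ((j.+1 ^ (m + U_(i))%MM j * ((m + U_(i))%MM j)`!)%:R)
  = \prod_(j < n | j != i) ((j.+1 ^ m j * (m j)`!)%:R) :> F.
  by apply: eq_bigr => j ji; rewrite mnmDE mnm1E eq_sym (negPf ji) addn0.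
rewrite mnmDE mnm1E eqxx addn1 expnS factS !natrM.
by ring.
Qed.

(** [scal] sums over the support of its first argument only; symmetry needs one list that serves
    both arguments. *)
Lemma scal_sub (s : seq 'X_{1..n}) f g : uniq s -> {subset msupp f <= s} ->
  scal f g = \sum_(m <- s) f@_m * g@_m * mwt m.
Proof.
move=> us fs; rewrite (bigID (mem (msupp f))) /= [X in _ + X]big1 ?addr0; last first.
  by move=> m /memN_msupp_eq0 ->; rewrite !mul0r.
rewrite -big_filter /scal.
have -> : \sum_(m <- msupp f) f@_m * g@_m * alpha ^+ mdeg m * zee m
  = \sum_(m <- msupp f) f@_m * g@_m * mwt m.
  by apply: eq_bigr => m _; rewrite /mwt mulrA.
apply: perm_big; apply: uniq_perm; rewrite ?filter_uniq ?msupp_uniq //.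
by move=> m; rewrite mem_filter; case: (boolP (m \in msupp f)) => //= /fs.
Qed.

Lemma scalC f g : scal f g = scal g f.
Proof.
have us := undup_uniq (msupp f ++ msupp g).
rewrite (scal_sub _ us); last by move=> m mf; rewrite mem_undup mem_cat mf.
rewrite [RHS](scal_sub _ us); last by move=> m mf; rewrite mem_undup mem_cat mf orbT.
by apply: eq_bigr => m _; rewrite (mulrC f@_m).
Qed.

Lemma scal_is_linear f : linear_for *%R (scal f).
Proof.
move=> c g h; rewrite /scal mulr_sumr -big_split /=.
by apply: eq_bigr => m _; rewrite mcoeffD mcoeffZ; ring.
Qed.

HB.instance Definition _ f :=
  GRing.isLinear.Build F (Lam n) F *%R (scal f) (scal_is_linear f).

Lemma scalDr f g h : scal f (g + h) = scal f g + scal f h.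
Proof. exact: linearD. Qed.
Lemma scalZr f c g : scal f (c *: g) = c * scal f g.
Proof. exact: linearZ. Qed.
Lemma scal0r f : scal f 0 = 0.
Proof. exact: linear0. Qed.
Lemma scalDl f g h : scal (f + g) h = scal f h + scal g h.
Proof. by rewrite scalC scalDr !(scalC h). Qed.
Lemma scalZl f c g : scal (c *: f) g = c * scal f g.
Proof. by rewrite scalC scalZr scalC. Qed.
Lemma scal0l f : scal 0 f = 0.
Proof. by rewrite scalC scal0r. Qed.
Lemma scal_suml (I : Type) (r : seq I) (Q : pred I) (G : I -> Lam n) f :
  scal (\sum_(i <- r | Q i) G i) f = \sum_(i <- r | Q i) scal (G i) f.
Proof. by rewrite scalC linear_sum; apply: eq_bigr => i _; rewrite scalC. Qed.
Lemma scal_sumr (I : Type) (r : seq I) (Q : pred I) (G : I -> Lam n) f :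
  scal f (\sum_(i <- r | Q i) G i) = \sum_(i <- r | Q i) scal f (G i).
Proof. by rewrite linear_sum. Qed.

Lemma scalXl m g : scal 'X_[m] g = g@_m * mwt m.
Proof.
by rewrite (@scal_sub [:: m]) ?msuppX // big_seq1 mcoeffX eqxx mul1r.
Qed.

Lemma scal_mulX i f g : scal ('X_i * f) g = alpha * i.+1%:R * scal f g^`M(i).
Proof.
elim/mpolyind: f => [|c m f _ _ IH]; first by rewrite mulr0 !scal0l mulr0.
rewrite mulrDr -scalerAr -mpolyXD !scalDl !scalZl IH !scalXl.
rewrite mcoeff_mderiv [(U_(i) + m)%MM]addmC mwtDU -mulr_natr.
by ring.
Qed.

(* [pw k] is p_k and [dw k] is d/dp_k, both 0 when k = 0 or k > n. They are locked
   because unification otherwise unfolds them down to the arithmetic of [F]. *)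
Definition pw (k : nat) : Lam n := locked (\sum_(i < n | i.+1 == k) 'X_i).
Definition dw (k : nat) f : Lam n := locked (\sum_(i < n | i.+1 == k) f^`M(i)).

Lemma pwS (i : 'I_n) : pw i.+1 = 'X_i.
Proof.
rewrite /pw -lock (bigD1 i) //= big1 ?addr0 // => j /andP[/eqP[] /val_inj ->].
by rewrite eqxx.
Qed.
Lemma dwS (i : 'I_n) f : dw i.+1 f = f^`M(i).
Proof.
rewrite /dw -lock (bigD1 i) //= big1 ?addr0 // => j /andP[/eqP[] /val_inj ->].
by rewrite eqxx.
Qed.
Lemma pw0 : pw 0 = 0. Proof. by rewrite /pw -lock big_pred0. Qed.
Lemma dw0 f : dw 0 f = 0. Proof. by rewrite /dw -lock big_pred0. Qed.
Lemma pw_big k : (n < k)%N -> pw k = 0.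
Proof.
move=> nk; rewrite /pw -lock big_pred0 // => i.
by apply/eqP => ik; have := ltn_ord i; lia.
Qed.
Lemma dw_big k f : (n < k)%N -> dw k f = 0.
Proof.
move=> nk; rewrite /dw -lock big_pred0 // => i.
by apply/eqP => ik; have := ltn_ord i; lia.
Qed.

Variant pw_dw_spec (k : nat) : Type :=
  | PwDwOut of (pw k = 0) & (forall f, dw k f = 0) & (k == 0)%N || (n < k)%N
  | PwDwIn (i : 'I_n) of k = i.+1.
Lemma pw_dwP k : pw_dw_spec k.
Proof.
case: k => [|k]; first by left; [exact: pw0 | exact: dw0 | ].
case: (ltnP k n) => kn; first by right with (Ordinal kn).
by left=> [|f|//]; [exact: pw_big | exact: dw_big].
Qed.

Lemma dw_is_linear k : linear (dw k).
Proof.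
move=> c f g; case: (pw_dwP k) => [_ H _|i ->]; first by rewrite !H scaler0 addr0.
by rewrite !dwS linearP.
Qed.
HB.instance Definition _ k :=
  GRing.isLinear.Build F (Lam n) (Lam n) *:%R (dw k) (dw_is_linear k).

Lemma dwM k f g : dw k (f * g) = dw k f * g + f * dw k g.
Proof.
case: (pw_dwP k) => [_ H _|i ->]; first by rewrite !H mul0r mulr0 addr0.
by rewrite !dwS mderivM.
Qed.

Lemma scal_pwM k f g : scal (pw k * f) g = alpha * k%:R * scal f (dw k g).
Proof.
case: (pw_dwP k) => [-> H _|i ->]; first by rewrite H mul0r scal0l scal0r mulr0.
by rewrite pwS dwS scal_mulX.
Qed.

Lemma scal_mulpw k f g : scal f (pw k * g) = alpha * k%:R * scal (dw k f) g.
Proof. by rewrite scalC scal_pwM scalC. Qed.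

Lemma dwC k l f : dw k (dw l f) = dw l (dw k f).
Proof.
case: (pw_dwP k) => [_ H _|i ->]; first by rewrite !H linear0.
case: (pw_dwP l) => [_ H _|j ->]; first by rewrite !H linear0.
by rewrite !dwS mderiv_comm.
Qed.

Lemma dwP k c f g : dw k (c *: f + g) = c *: dw k f + dw k g.
Proof. exact: dw_is_linear. Qed.

Lemma scale_mul_linear c0 c (p f g : Lam n) :
  c0 *: (p * (c *: f + g)) = c *: (c0 *: (p * f)) + c0 *: (p * g).
Proof. by rewrite -!mul_mpolyC; ring. Qed.

Lemma sum_is_linear (I : Type) (r : seq I) (G : I -> Lam n -> Lam n) :
  (forall i, linear (G i)) -> linear (fun f => \sum_(i <- r) G i f).
Proof.
move=> HG c f g; rewrite scaler_sumr -big_split /=.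
by apply: eq_bigr => i _; apply: HG.
Qed.

Lemma add_is_linear (G H : Lam n -> Lam n) :
  linear G -> linear H -> linear (fun f => G f + H f).
Proof. by move=> HG HH c f g; rewrite HG HH scalerDr addrACA. Qed.

Lemma scale_is_linear (a : F) (G : Lam n -> Lam n) :
  linear G -> linear (fun f => a *: G f).
Proof. by move=> HG c f g; rewrite HG scalerDr !scalerA mulrC. Qed.

Definition DL_join : Lam n -> Lam n :=
  locked (fun f => \sum_(i < n.+1) \sum_(j < n.+1)
    (i * j)%:R *: (pw (i + j) * dw i (dw j f))).
Definition DL_cut : Lam n -> Lam n :=
  locked (fun f => \sum_(i < n.+1) \sum_(j < n.+1)
    (i + j)%:R *: (pw i * pw j * dw (i + j) f)).
Definition DL_diag : Lam n -> Lam n :=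
  locked (fun f => \sum_(i < n.+1) (i ^ 2)%:R *: (pw i * dw i f)).

(* The Laplace-Beltrami operator in power-sum coordinates; truncating at p_n is
   harmless in weights at most n and keeps the operator self-adjoint. *)
Definition DL f : Lam n :=
  (alpha / 2%:R) *: DL_join f + 2%:R^-1 *: DL_cut f
  + ((alpha - 1) / 2%:R) *: DL_diag f.

Lemma DL_is_linear : linear DL.
Proof.
have H1 : linear DL_join.
  rewrite /DL_join -lock.
  apply: sum_is_linear => i; apply: sum_is_linear => j c f g.
  by rewrite !dwP scale_mul_linear.
have H2 : linear DL_cut.
  rewrite /DL_cut -lock.
  apply: sum_is_linear => i; apply: sum_is_linear => j c f g.
  by rewrite dwP scale_mul_linear.
have H3 : linear DL_diag.
  rewrite /DL_diag -lock.
  by apply: sum_is_linear => i c f g; rewrite dwP scale_mul_linear.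
by apply: add_is_linear; [apply: add_is_linear|]; apply: scale_is_linear.
Qed.
HB.instance Definition _ :=
  GRing.isLinear.Build F (Lam n) (Lam n) *:%R DL DL_is_linear.

(** Term by term: two derivatives cross the scalar product with factor $\alpha^2ij$, one with
    $\alpha(i+j)$. The surplus $\alpha$ explains the unequal weights $\alpha/2$ and $1/2$ in
    [DL]. *)
Lemma DL_join_adj f g :
  alpha / 2%:R * scal (DL_join f) g = 2%:R^-1 * scal f (DL_cut g).
Proof.
rewrite /DL_join /DL_cut -!lock /= scal_suml scal_sumr !mulr_sumr; apply: eq_bigr => i _.
rewrite scal_suml scal_sumr !mulr_sumr; apply: eq_bigr => j _.
rewrite scalZl scalZr -[pw i * _ * _]mulrA scal_pwM !scal_mulpw dwC natrM natrD.
by ring.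
Qed.

Lemma scal_comb3 (a b c : F) (f1 f2 f3 g : Lam n) :
  scal (a *: f1 + b *: f2 + c *: f3) g
  = a * scal f1 g + b * scal f2 g + c * scal f3 g.
Proof. by rewrite !scalDl !scalZl. Qed.

Lemma DL_diag_adj f g : scal (DL_diag f) g = scal f (DL_diag g).
Proof.
rewrite /DL_diag -!lock /= scal_suml scal_sumr; apply: eq_bigr => i _.
by rewrite scalZl scalZr scal_pwM scal_mulpw.
Qed.

Lemma DL_adj f g : scal (DL f) g = scal f (DL g).
Proof.
rewrite [RHS]scalC /DL !scal_comb3 !DL_join_adj.
rewrite [scal (DL_cut f) g]scalC [scal (DL_cut g) f]scalC -!DL_join_adj.
rewrite DL_diag_adj [scal f (DL_diag g)]scalC.
by rewrite [scal (DL_join f) g]scalC [scal (DL_join g) f]scalC [X in X + _ = _]addrC.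
Qed.

End Scal.

(** * Action on the functions Q_a and their products *)

Lemma invM_cancel (x y z : F) : y != 0 -> (x * y * z)^-1 * y = x^-1 * z^-1.
Proof. by move=> y0; rewrite !invfM mulrAC divfK. Qed.

Lemma alphaM_neq0 k : alpha * k.+1%:R != 0.
Proof. by apply: mulf_neq0; [exact: alpha_neq0 | rewrite natF_eq0]. Qed.

Section CompleteFunctions.
Variable n : nat.
Implicit Types (f g : Lam n) (m : 'X_{1..n}).
Local Notation Q := (Qk n).
Local Notation pw := (@pw n).
Local Notation dw := (@dw n).

Lemma mdeg_le_pweight m : (mdeg m <= pweight m)%N.
Proof. by rewrite mdegE leq_sum // => i _; rewrite leq_pmull. Qed.

Lemma pweightDU m i : pweight (m + U_(i)) = (pweight m + i.+1)%N.
Proof.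
rewrite /pweight (bigD1 i) //= [in RHS](bigD1 i) //= mnmDE mnm1E eqxx.
rewrite (eq_bigr (fun j : 'I_n => j.+1 * m j)%N); first by lia.
by move=> j ji; rewrite mnmDE mnm1E eq_sym (negPf ji) addn0.
Qed.

Lemma mcoeff_Qk a m : (Q a)@_m = if pweight m == a then (mwt m)^-1 else 0.
Proof.
have wtE (m' : 'X_{1..n}) : alpha ^- mdeg m' / zee m' = (mwt m')^-1.
  by rewrite /mwt invfM.
rewrite /Qk raddf_sum /=.
case: eqP => [ma|ma]; last first.
  rewrite big1 // => m' /eqP m'a; rewrite mcoeffZ mcoeffX.
  by case: eqP => [mm|]; [case: ma; rewrite -mm | rewrite mulr0].
have ltm : (mdeg m < a.+1)%N by rewrite ltnS -ma mdeg_le_pweight.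
rewrite (bigD1 (BMultinom ltm)) ?ma //= mcoeffZ mcoeffX eqxx mulr1 wtE.
rewrite big1 ?addr0 // => m' /andP[_ m'm]; rewrite mcoeffZ mcoeffX.
case: eqP => [mm|]; last by rewrite mulr0.
by case/eqP: m'm; apply: val_inj.
Qed.

(** The guard is essential: truncated subtraction would give $Q_0=1$ instead of 0 for $k>a$. *)
Definition Qsub a k : Lam n := if (k <= a)%N then Q (a - k) else 0.

Lemma QsubE a k : Qsub a k = if (k <= a)%N then Q (a - k) else 0.
Proof. by []. Qed.
Lemma Qsub0 a : Qsub a 0 = Q a. Proof. by rewrite /Qsub subn0. Qed.
Lemma QsubS a k : Qsub a.+1 k.+1 = Qsub a k. Proof. by rewrite /Qsub subSS. Qed.
Lemma Qsub_big a k : (a < k)%N -> Qsub a k = 0.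
Proof. by move=> ak; rewrite /Qsub leqNgt ak. Qed.
Lemma Qk_0 : Q 0 = 1.
Proof.
apply/mpolyP => m; rewrite mcoeff_Qk mcoeff1.
case: (eqVneq m 0%MM) => [->|m0].
  by rewrite mwt0 invr1 /pweight big1 // => i _; rewrite mnm0E muln0.
case: eqP => // pm0; case/eqP: m0; apply/eqP; rewrite -mdeg_eq0 -leqn0 -pm0.
exact: mdeg_le_pweight.
Qed.

(** For $k>n$ the left side is 0, so $a\le n$ is wanted to make $Q_{a-k}$ vanish too; for $k=0$ both
    sides are 0 because $0^{-1}=0$. *)
Lemma dw_Q a k : (k <= n)%N || (a <= n)%N ->
  dw k (Q a) = (alpha * k%:R)^-1 *: Qsub a k.
Proof.
case: (pw_dwP n k) => [_ -> |i -> _]; last first.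
  apply/mpolyP => m; rewrite dwS mcoeff_mderiv mcoeff_Qk pweightDU mcoeffZ /Qsub.
  have [ia|ia] := leqP i.+1 a; last first.
    by rewrite mcoeff0 mulr0 ifF ?mul0rn //; lia.
  rewrite mcoeff_Qk -[pweight m == _](eqn_add2r i.+1) subnK //.
  case: eqP => _; last by rewrite mulr0 mul0rn.
  by rewrite mwtDU -[LHS]mulr_natr invM_cancel // natF_eq0.
case: (posnP k) => [-> _ _|k0 /= nk]; first by rewrite mulr0 invr0 scale0r.
by case/orP=> H; rewrite ?Qsub_big ?scaler0 //; lia.
Qed.

Lemma dw_Qsub a j k : (a <= n)%N ->
  dw k (Qsub a j) = (alpha * k%:R)^-1 *: Qsub a (k + j).
Proof.
move=> an; rewrite {1}/Qsub; case: leqP => ja.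
  rewrite dw_Q; last by apply/orP; right; lia.
  congr (_ *: _); rewrite /Qsub.
  by case: leqP => h1; case: leqP => h2; try lia; rewrite // -subnDA addnC.
by rewrite linear0 Qsub_big ?scaler0 //; lia.
Qed.

Lemma sum_pw (G : nat -> Lam n -> Lam n) : (forall k, G k 0 = 0) ->
  \sum_(k < n.+1) G k (pw k) = \sum_(i < n) G i.+1 'X_i.
Proof.
move=> G0; rewrite big_ord_recl pw0 G0 add0r.
by apply: eq_bigr => i _; rewrite /= /bump /= add1n pwS.
Qed.

Lemma euler_X m :
  \sum_(i < n) i.+1%:R *: ('X_i * ('X_[m])^`M(i)) = (pweight m)%:R *: ('X_[m] : Lam n).
Proof.
rewrite /pweight natr_sum scaler_suml; apply: eq_bigr => i _.
rewrite mderivX -scalerAr scalerA -natrM.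
case: (posnP (m i)) => [->|mi]; first by rewrite muln0 !scale0r.
by rewrite -mpolyXD addmC submK // lep1mP -lt0n.
Qed.

(** Newton's identity: the Euler operator $\sum_k k\,p_k\,\partial/\partial p_k$ multiplies $Q_a$ by
    its weight $a$, and [dw_Q] evaluates the derivatives. *)
Lemma euler_Q a : \sum_(k < n.+1) pw k * Qsub a k = (alpha * a%:R) *: Q a.
Proof.
transitivity (alpha *: \sum_(i < n) i.+1%:R *: ('X_i * (Q a)^`M(i))).
  rewrite (sum_pw (G := fun k p => p * Qsub a k)); last by move=> k; rewrite mul0r.
  rewrite scaler_sumr; apply: eq_bigr => i _.
  rewrite -dwS dw_Q ?ltn_ord // -scalerAr !scalerA divff ?scale1r //.
  exact: alphaM_neq0.
rewrite -scalerA; congr (_ *: _).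
rewrite /Qk scaler_sumr.
under eq_bigr do rewrite raddf_sum mulr_sumr scaler_sumr.
rewrite exchange_big /=; apply: eq_bigr => m /eqP ma.
have -> : a%:R = (pweight m)%:R :> F by rewrite ma.
move: (alpha ^- _ / _) => c.
rewrite scalerA [(pweight m)%:R * _]mulrC -scalerA -euler_X scaler_sumr.
by apply: eq_bigr => i _; rewrite mderivZ -scalerAr !scalerA mulrC.
Qed.

(** With indices shifted by one, the sum of $p_{k+l}Q_{a-k}Q_{b-l}$ over $k,l\ge1$; up to a factor
    $\alpha$ it is the mixed term of $D(Q_aQ_b)$. *)
Definition Tsum a b : Lam n :=
  \sum_(k < n) \sum_(l < n) pw (k + l).+2 * (Qsub a k.+1 * Qsub b l.+1).

Lemma sum2_ord_shift (G : nat -> nat -> Lam n) :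
  (forall k, G k n = 0) -> (forall l, G n l = 0) ->
  \sum_(k < n) \sum_(l < n) G k.+1 l + \sum_(l < n.+1) G 0 l
  = \sum_(k < n) \sum_(l < n) G k l.+1 + \sum_(k < n.+1) G k 0.
Proof.
move=> Gr Gl.
transitivity (\sum_(k < n.+1) \sum_(l < n.+1) G k l).
  rewrite [RHS]big_ord_recl addrC; congr (_ + _); apply: eq_bigr => k _.
  by rewrite big_ord_recr /= Gr addr0.
rewrite exchange_big big_ord_recl addrC; congr (_ + _).
rewrite [RHS]exchange_big; apply: eq_bigr => l _ /=.
by rewrite big_ord_recr /= Gl addr0.
Qed.

(* Both sums are subsums of the sum of p_{k+l+1} Q_{a-k} Q_{b-l} over k, l >= 0: one
   omits the row k = 0, the other the column l = 0. *)
Lemma TsumS a b : (a + b.+1 <= n)%N ->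
  Tsum a b.+1 + (alpha * b.+1%:R) *: (Q a * Q b.+1)
  = Tsum a.+1 b + (alpha * a.+1%:R) *: (Q a.+1 * Q b).
Proof.
move=> abn.
have eu c : (c < n)%N ->
    \sum_(k < n.+1) pw k.+1 * Qsub c k = (alpha * c.+1%:R) *: Q c.+1.
  move=> cn; rewrite -euler_Q [RHS]big_ord_recl pw0 mul0r add0r big_ord_recr /=.
  rewrite pw_big // mul0r addr0.
  by apply: eq_bigr => k _; rewrite /bump /= add1n QsubS.
have Ga k : pw (k + n).+1 * (Qsub a k * Qsub b n) = 0.
  by rewrite [Qsub b n]Qsub_big ?mulr0 //; lia.
have Gb l : pw (n + l).+1 * (Qsub a n * Qsub b l) = 0.
  by rewrite [Qsub a n]Qsub_big ?mul0r ?mulr0 //; lia.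
have H := @sum2_ord_shift (fun k l => pw (k + l).+1 * (Qsub a k * Qsub b l)) Ga Gb.
rewrite /Tsum.
under eq_bigr do under eq_bigr do rewrite QsubS.
under [in RHS]eq_bigr do under eq_bigr do rewrite QsubS -addnS.
have -> : (alpha * b.+1%:R) *: (Q a * Q b.+1)
   = \sum_(l < n.+1) pw (0 + l).+1 * (Qsub a 0 * Qsub b l).
  rewrite scalerAr -eu; last by lia.
  rewrite mulr_sumr; apply: eq_bigr => l _; rewrite add0n Qsub0.
  by rewrite mulrCA.
etransitivity; first exact: H.
congr (_ + _).
rewrite scalerAl -eu; last by lia.
by rewrite mulr_suml; apply: eq_bigr => k _; rewrite addn0 Qsub0 mulrA.
Qed.

(** Repeating [TsumS] brings $b$ down to 0, where [Tsum] vanishes. The term $-bQ_aQ_b$ is what the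
    first step leaves unpaired. *)
Lemma TsumE a b : (a + b <= n)%N ->
  Tsum a b = alpha *: (\sum_(s < b) (a%:R - b%:R + (2 * s.+1)%:R) *:
                          (Q (a + s.+1) * Q (b - s.+1)) - b%:R *: (Q a * Q b)).
Proof.
elim: b a => [|b IH] a abn.
  rewrite big_ord0 scale0r subr0 scaler0 /Tsum big1 // => k _.
  by rewrite big1 // => l _; rewrite [Qsub 0 _]Qsub_big // !mulr0.
have := TsumS abn; rewrite IH; last by rewrite addSnnS.
move/(canRL (addrK _)) => ->.
rewrite big_ord_recl /= subSS subn0 addn1.
have -> : \sum_(i < b) (a%:R - b.+1%:R + (2 * (bump 0 i).+1)%:R) *:
      (Q (a + (bump 0 i).+1) * Q (b.+1 - (bump 0 i).+1))
    = \sum_(s < b) (a.+1%:R - b%:R + (2 * s.+1)%:R) *: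
        (Q (a.+1 + s.+1) * Q (b - s.+1)).
  apply: eq_bigr => i _; rewrite /bump /= add1n subSS addnS addSn; congr (_ *: _).
  by ring.
move: (\sum_(s < b) _) => S.
move: (Q a * Q b.+1) (Q a.+1 * Q b) => Y X.
rewrite -!mul_mpolyC.
ring.
Qed.
End CompleteFunctions.

(** * Eigenfunctions $Q_a$ and the defect of the Leibniz rule *)

Lemma cancel_join (K : fieldType) (b x y : K) : x != 0 -> y != 0 -> b != 0 ->
  x * y * ((b * y)^-1 / (b * x)) = b ^- 2.
Proof. by move=> x0 y0 b0; field; rewrite b0 x0 y0. Qed.

Lemma cancel_diag (K : fieldType) (b x : K) : x != 0 -> b != 0 ->
  x * x * (b * x)^-1 = x / b.
Proof. by move=> x0 b0; field; rewrite b0 x0. Qed.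

Lemma cancel_BL (K : fieldType) (b x y : K) : x != 0 -> y != 0 -> b != 0 ->
  b * (x * y) * ((b * y)^-1 / (b * x)) = b^-1.
Proof. by move=> x0 y0 b0; field; rewrite b0 x0 y0. Qed.

Lemma DL_coef (K : fieldType) (b x y : K) : b != 0 -> 2%:R != 0 :> K ->
  b / 2%:R / b ^+ 2 * (x - 1) + 2%:R^-1 * (y - x) + (b - 1) / 2%:R * (x / b)
  = (y - b^-1) / 2%:R.
Proof. by move=> b0 h2; field; rewrite b0 h2. Qed.

Lemma eps_coef (K : fieldType) (b y : K) : b != 0 ->
  (y - b^-1) / 2%:R * (b * y) = (b * (y * y) - y) / 2%:R.
Proof. by move=> b0; rewrite mulrAC; congr (_ / _); field. Qed.

Section Eigenfunctions.
Variable n : nat.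
Implicit Types (f g : Lam n).
Local Notation Q := (Qk n).
Local Notation Qsub := (@Qsub n).
Local Notation pw := (@pw n).
Local Notation dw := (@dw n).

(** An integer $m$ is a sum of two positive integers in $m-1$ ways; the truncated predecessor gives
    the right count at $m=0$ as well. *)
Lemma sum_antidiag (H : nat -> Lam n) : (forall m, (n < m)%N -> H m = 0) ->
  \sum_(i < n) \sum_(j < n) H (i + j).+2 = \sum_(m < n.+1) m.-1%:R *: H m.
Proof.
move=> Hn.
transitivity (\sum_(i < n) \sum_(m < n.+1 | (i.+1 < m)%N) H m).
  apply: eq_bigr => i _.
  have iN : (i.+2 <= n.+1)%N by rewrite ltnS ltn_ord.
  rewrite -(big_geq_mkord _ _ predT) -(big_mkord predT (fun j => H (i + j).+2)).
  transitivity (\sum_(i.+2 <= m < n + i.+2) H m).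
    rewrite -[X in \sum_(X <= _ < n + _) _](add0n i.+2) big_addn addnK.
    by apply: eq_bigr => j _; rewrite addnC !addnS addnC.
  have nN : (n.+1 <= n + i.+2)%N by rewrite -addSnnS leq_addr.
  rewrite (big_cat_nat iN nN) /=.
  rewrite [X in _ + X]big_nat_cond [X in _ + X]big1 ?addr0 // => m.
  by rewrite andbT => /andP[nm _]; apply: Hn.
rewrite (exchange_big_dep predT) //=; apply: eq_bigr => m _.
rewrite (eq_bigl (fun i : 'I_n => (i < m.-1)%N)); last by move=> i; lia.
rewrite (big_ord_narrow (n1 := m.-1)); first by have := ltn_ord m; lia.
by rewrite sumr_const card_ord scaler_nat.
Qed.

Lemma sum2_recl (G : nat -> nat -> Lam n) :
  (forall j, G 0%N j = 0) -> (forall i, G i 0%N = 0) ->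
  \sum_(i < n.+1) \sum_(j < n.+1) G i j = \sum_(i < n) \sum_(j < n) G i.+1 j.+1.
Proof.
move=> Gl Gr; rewrite big_ord_recl big1 // add0r; apply: eq_bigr => i _.
by rewrite big_ord_recl Gr add0r; apply: eq_bigr => j _; rewrite !lift0.
Qed.

Lemma DL_joinE f : DL_join f = \sum_(i < n.+1) \sum_(j < n.+1)
   (i * j)%:R *: (pw (i + j) * dw i (dw j f)).
Proof. by rewrite /DL_join -lock. Qed.
Lemma DL_cutE f : DL_cut f = \sum_(i < n.+1) \sum_(j < n.+1)
   (i + j)%:R *: (pw i * pw j * dw (i + j) f).
Proof. by rewrite /DL_cut -lock. Qed.
Lemma DL_diagE f : DL_diag f = \sum_(i < n.+1) (i ^ 2)%:R *: (pw i * dw i f).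
Proof. by rewrite /DL_diag -lock. Qed.

(** At index 0 the scalars need not match, because of $0^{-1}=0$ and truncated predecessors; $p_0=0$
    absorbs the discrepancy. *)
Lemma pw0_scale (c d : F) f : c *: (pw 0 * f) = d *: (pw 0 * f).
Proof. by rewrite pw0 mul0r !scaler0. Qed.

Lemma DL_join_Q a : (a <= n)%N ->
  DL_join (Q a) = alpha ^- 2 *: (\sum_(m < n.+1) m.-1%:R *: (pw m * Qsub a m)).
Proof.
move=> an.
rewrite -(sum_antidiag (H := fun m => pw m * Qsub a m)); last first.
  by move=> m nm; rewrite pw_big ?mul0r.
rewrite DL_joinE (sum2_recl (G := fun i j =>
  (i * j)%:R *: (pw (i + j) * dw i (dw j (Q a))))) => [|j|i]; first last.
- by rewrite muln0 scale0r.
- by rewrite scale0r.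
rewrite scaler_sumr; apply: eq_bigr => i _.
rewrite scaler_sumr; apply: eq_bigr => j _.
rewrite dw_Q ?an ?orbT // linearZ /= dw_Qsub // -!scalerAr !scalerA.
rewrite addSn addnS; congr (_ *: _).
rewrite natrM.
move: (negbT (natF_eq0 i.+1)) (negbT (natF_eq0 j.+1)) alpha_neq0.
exact: cancel_join.
Qed.

Lemma DL_cut_Q a : (a <= n)%N ->
  DL_cut (Q a) = \sum_(i < n.+1) (a - i)%:R *: (pw i * Qsub a i).
Proof.
move=> an; rewrite DL_cutE; apply: eq_bigr => i _.
transitivity (alpha^-1 *: (pw i * \sum_(j < n.+1) pw j * Qsub a (i + j))).
  rewrite mulr_sumr scaler_sumr; apply: eq_bigr => j _.
  rewrite dw_Q ?an ?orbT // -[pw i * _ * _]mulrA -!scalerAr scalerA.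
  case: (posnP (i + j)) => [ij|ij0].
    have -> : nat_of_ord i = 0%N by lia.
    exact: pw0_scale.
  by rewrite invfM mulrCA mulfV ?mulr1 // natF_eq0 -lt0n.
have [ia|ia] := leqP i a; last first.
  rewrite Qsub_big // mulr0 scaler0 big1 ?mulr0 ?scaler0 // => j _.
  by rewrite Qsub_big ?mulr0 //; lia.
have -> : \sum_(j < n.+1) pw j * Qsub a (i + j) = (alpha * (a - i)%:R) *: Q (a - i).
  rewrite -euler_Q; apply: eq_bigr => j _; congr (_ * _).
  by rewrite !QsubE leq_subRL // subnDA.
rewrite -scalerAr scalerA mulrA mulVf ?alpha_neq0 // mul1r.
by rewrite QsubE ia.
Qed.

Lemma DL_diag_Q a : (a <= n)%N ->
  DL_diag (Q a) = \sum_(i < n.+1) (i%:R / alpha) *: (pw i * Qsub a i).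
Proof.
move=> an; rewrite DL_diagE; apply: eq_bigr => i _.
rewrite dw_Q ?an ?orbT // -scalerAr scalerA.
case: (posnP i) => [->|i0]; first exact: pw0_scale.
congr (_ *: _); rewrite natrM.
by apply: cancel_diag; [rewrite natF_eq0 -lt0n | exact: alpha_neq0].
Qed.

Definition eps (a : nat) : F := (alpha * (a ^ 2)%:R - a%:R) / 2%:R.

(** All three parts of $D$ give combinations of $p_mQ_{a-m}$, with coefficients $(m-1)/2\alpha$,
    $(a-m)/2$ and $(\alpha-1)m/2\alpha$. Their sum $(a-\alpha^{-1})/2$ is independent of $m$, so
    [euler_Q] applies. *)
Lemma DL_Q a : (a <= n)%N -> DL (Q a) = eps a *: Q a.
Proof.
move=> an; rewrite /DL DL_join_Q // DL_cut_Q // DL_diag_Q //.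
have -> : eps a *: Q a
    = ((a%:R - alpha^-1) / 2%:R) *: \sum_(m < n.+1) pw m * Qsub a m.
  rewrite euler_Q scalerA; congr (_ *: _); rewrite /eps natrM.
  by rewrite eps_coef //; exact: alpha_neq0.
rewrite !scaler_sumr -!big_split /=; apply: eq_bigr => m _.
have [ma|ma] := leqP m a; last first.
  by rewrite Qsub_big // mulr0; move: (m.-1%:R) => c; rewrite !scaler0 !addr0.
rewrite !scalerA -!scalerDl.
case: (posnP m) => [->|m0]; first exact: pw0_scale.
congr (_ *: _); rewrite natrB // -subn1 natrB //.
by apply: DL_coef; [exact: alpha_neq0 | rewrite natF_eq0].
Qed.

(** The bilinear defect of the Leibniz rule for [DL]. Only [DL_join] has order two; its two mixed
    sums coincide, which cancels the 1/2 in front of it. *)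
Definition BL f g : Lam n := locked (alpha *: \sum_(i < n.+1) \sum_(j < n.+1)
   (i * j)%:R *: (pw (i + j) * (dw i f * dw j g))).
Lemma BLE f g : BL f g = alpha *: \sum_(i < n.+1) \sum_(j < n.+1)
   (i * j)%:R *: (pw (i + j) * (dw i f * dw j g)).
Proof. by rewrite /BL -lock. Qed.

Lemma sum_leibniz (I : Type) (r : seq I) (A B C E : I -> Lam n) f g :
  (forall i, A i = B i * g + f * C i + E i) ->
  \sum_(i <- r) A i = (\sum_(i <- r) B i) * g + f * (\sum_(i <- r) C i)
                      + \sum_(i <- r) E i.
Proof.
move=> H; rewrite mulr_suml mulr_sumr -!big_split /=.
by apply: eq_bigr => i _; apply: H.
Qed.

Lemma sum_leibniz0 (I : Type) (r : seq I) (A B C : I -> Lam n) f g :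
  (forall i, A i = B i * g + f * C i) ->
  \sum_(i <- r) A i = (\sum_(i <- r) B i) * g + f * (\sum_(i <- r) C i).
Proof.
move=> H; rewrite mulr_suml mulr_sumr -!big_split /=.
by apply: eq_bigr => i _; apply: H.
Qed.

Definition BLsum f g : Lam n := \sum_(i < n.+1) \sum_(j < n.+1)
  (i * j)%:R *: (pw (i + j) * (dw i f * dw j g)).

Lemma BLsumC f g : BLsum g f = BLsum f g.
Proof.
rewrite /BLsum; etransitivity; first exact: exchange_big.
apply: eq_bigr => i _; apply: eq_bigr => j _ /=.
by rewrite mulnC addnC (mulrC (dw j g)).
Qed.

Lemma DL_joinM f g :
  DL_join (f * g) = DL_join f * g + f * DL_join g + (BLsum f g + BLsum g f).
Proof.
have -> : BLsum f g + BLsum g f = \sum_(i < n.+1) \sum_(j < n.+1)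
    (i * j)%:R *: (pw (i + j) * (dw i f * dw j g + dw i g * dw j f)).
  rewrite /BLsum -big_split; apply: eq_bigr => i _; rewrite -big_split.
  by apply: eq_bigr => j _ /=; rewrite mulrDr scalerDr.
rewrite !DL_joinE; apply: sum_leibniz => i; apply: sum_leibniz => j.
rewrite dwM linearD /= !dwM.
move: (dw i (dw j f)) (dw i (dw j g)) (dw i f) (dw j f) (dw i g) (dw j g).
by move: (pw (i + j)) => *; rewrite -!mul_mpolyC; ring.
Qed.

Lemma DLM f g : DL (f * g) = DL f * g + f * DL g + BL f g.
Proof.
have Hj := DL_joinM f g.
have Hc : DL_cut (f * g) = DL_cut f * g + f * DL_cut g.
  rewrite !DL_cutE; apply: sum_leibniz0 => i.
  apply: sum_leibniz0 => j.
  by rewrite dwM -!mul_mpolyC; ring.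
have Hd : DL_diag (f * g) = DL_diag f * g + f * DL_diag g.
  rewrite !DL_diagE; apply: sum_leibniz0 => i.
  by rewrite dwM -!mul_mpolyC; ring.
rewrite BLE -/(BLsum f g) /DL Hj Hc Hd (BLsumC f g); move: (BLsum f g) => Z.
rewrite -[alpha in alpha *: Z](@divfK _ 2%:R) ?natF_eq0 //.
move: (alpha / 2%:R) ((alpha - 1) / 2%:R) (2%:R^-1) => c1 c2 c3.
move: (DL_join f) (DL_join g) (DL_cut f) (DL_cut g) (DL_diag f) (DL_diag g).
by move=> *; rewrite -!mul_mpolyC; ring.
Qed.

(** Being a derivation in the second argument, the defect on products reduces to pairs of factors
    $Q_a$, $Q_b$. *)
Lemma BLM f g h : BL f (g * h) = BL f g * h + g * BL f h.
Proof.
rewrite !BLE -scalerAl -scalerAr -scalerDr; congr (_ *: _).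
apply: sum_leibniz0 => i; apply: sum_leibniz0 => j; rewrite dwM.
move: (dw i f) (dw j g) (dw j h) (pw (i + j)) => *.
by rewrite -!mul_mpolyC; ring.
Qed.

Lemma BL_1 f : BL f 1 = 0.
Proof.
apply: (addIr (BL f 1)); rewrite add0r.
by rewrite -[in RHS](mulr1 1) BLM mulr1 mul1r.
Qed.

Lemma BL_QQ a b : (a <= n)%N -> (b <= n)%N -> BL (Q a) (Q b) = alpha^-1 *: Tsum n a b.
Proof.
move=> an bn; rewrite BLE /Tsum (sum2_recl (G := fun i j =>
  (i * j)%:R *: (pw (i + j) * (dw i (Q a) * dw j (Q b))))) => [|j|i]; first last.
- by rewrite muln0 scale0r.
- by rewrite scale0r.
rewrite !scaler_sumr; apply: eq_bigr => i _.
rewrite !scaler_sumr; apply: eq_bigr => j _.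
rewrite !dw_Q ?an ?bn ?orbT // addSn addnS.
move: (Qsub a i.+1) (Qsub b j.+1) (pw _) => f g h.
rewrite -!(scalerAr, scalerAl) !scalerA; congr (_ *: _).
rewrite natrM.
move: (negbT (natF_eq0 i.+1)) (negbT (natF_eq0 j.+1)) alpha_neq0.
exact: cancel_BL.
Qed.

End Eigenfunctions.

(** * The operator on products of the $Q_a$ *)

Definition mv (s : seq nat) i j k : seq nat :=
  set_nth 0%N (set_nth 0%N s i (nth 0%N s i + k)%N) j (nth 0%N s j - k)%N.

Definition mv_coef (s : seq nat) i j k : F :=
  (nth 0%N s i)%:R - (nth 0%N s j)%:R + (2 * k)%:R.

(** The diagonal coefficient of $D$ on $q_s$: each part contributes its own eigenvalue, and a part
    with $i$ parts in front of it loses itself $i$ times through the term $-bQ_aQ_b$ of [TsumE]. *)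
Definition eigen (s : seq nat) : F :=
  \sum_(x <- s) eps x - \sum_(i < size s) (i * nth 0%N s i)%:R.

Lemma eigen_cons a s : eigen (a :: s) = eps a + eigen s - (sumn s)%:R.
Proof.
rewrite /eigen big_cons /= big_ord_recl mul0n add0r -!addrA; congr (_ + (_ + _)).
rewrite sumnE (big_nth 0%N) big_mkord natr_sum -opprD -big_split /=.
by congr (- _); apply: eq_bigr => i _; rewrite -natrD /bump /= mulSn addnC.
Qed.

Section Products.
Variable n : nat.
Local Notation Q := (Qk n).
Local Notation qla := (qla n).

Lemma qla_cons a s : qla (a :: s) = Q a * qla s.
Proof. by rewrite /Defs.qla big_cons. Qed.

Lemma qla_nil : qla [::] = 1.
Proof. by rewrite /Defs.qla big_nil. Qed.

Lemma BL_qla a s : (a + sumn s <= n)%N ->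
  BL (Q a) (qla s) =
    \sum_(j < size s) \sum_(k < nth 0%N s j)
      (a%:R - (nth 0%N s j)%:R + (2 * k.+1)%:R) *:
        (Q (a + k.+1) * qla (set_nth 0%N s j (nth 0%N s j - k.+1)%N))
    - (sumn s)%:R *: (Q a * qla s).
Proof.
elim: s => [|b s IH] /= abn.
  by rewrite qla_nil BL_1 big_ord0 scale0r subrr.
rewrite qla_cons BLM IH; last by lia.
rewrite BL_QQ; [|by lia..].
rewrite TsumE; last by lia.
rewrite scalerA mulVf ?scale1r; last exact: alpha_neq0.
rewrite [in RHS]big_ord_recl /=.
set S1 := \sum_(s0 < b) _; set S2 := \sum_(j < size s) _.
set R1 := \sum_(k < b) _; set R2 := \sum_(i < size s) _.
have -> : R1 = S1 * qla s.
  rewrite mulr_suml; apply: eq_bigr => k _.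
  by rewrite qla_cons -scalerAl mulrA.
have -> : R2 = Q b * S2.
  rewrite mulr_sumr; apply: eq_bigr => j _.
  rewrite mulr_sumr; apply: eq_bigr => k _ /=.
  by rewrite qla_cons -scalerAr; congr (_ *: _); rewrite mulrCA.
move: S1 S2 (Q a) (Q b) (qla s) => S1 S2 A B C.
by rewrite natrD -!mul_mpolyC; ring.
Qed.

Lemma DL_1 : DL (1 : Lam n) = 0.
Proof.
have := @DL_Q n 0 (leq0n n).
by rewrite Qk_0 /eps mulr0 subrr mul0r scale0r.
Qed.

(** Induction on the list: moves raising the head come from the defect [BL_qla], moves inside the
    tail from the induction hypothesis. *)
Lemma DL_qla s : (sumn s <= n)%N ->
  DL (qla s) = eigen s *: qla s
    + \sum_(i < size s) \sum_(j < size s | (i < j)%N) \sum_(k < nth 0%N s j)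
        mv_coef s i j k.+1 *: qla (mv s i j k.+1).
Proof.
elim: s => [|a s IH] /= abn.
  by rewrite qla_nil DL_1 big_ord0 /eigen big_nil big_ord0 subrr scale0r addr0.
rewrite qla_cons DLM IH; last by lia.
rewrite BL_qla // DL_Q; last by lia.
rewrite [in RHS]big_ord_recl /=.
set S1 := \sum_(i < size s) _; set S2 := \sum_(j < size s) _.
set R1 := \sum_(i < (size s).+1 | _) _; set R2 := \sum_(i < size s) _.
have -> : R1 = S2.
  rewrite /R1 big_mkcond big_ord_recl /= add0r; apply: eq_bigr => j _.
  apply: eq_bigr => k _.
  by rewrite /mv_coef /mv /= qla_cons.
have -> : R2 = Q a * S1.
  rewrite mulr_sumr; apply: eq_bigr => i _.
  rewrite big_mkcond big_ord_recl /= add0r mulr_sumr [RHS]big_mkcond /=.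
  apply: eq_bigr => j _; rewrite /bump /= !add1n ltnS; case: ifP => // _.
  rewrite mulr_sumr; apply: eq_bigr => k _ /=.
  by rewrite qla_cons -scalerAr.
rewrite eigen_cons.
move: S1 S2 (Q a) (qla s) => S1 S2 A B.
by rewrite -!mul_mpolyC; ring.
Qed.
End Products.

(** * Duality with the monomials *)

Section Evaluation.
Variable n : nat.
Implicit Types (f g : Lam n) (m : 'X_{1..n}).

Lemma mcoeffXM (p : {mpoly F[n]}) k m :
  ('X_[k] * p)@_m = if (k <= m)%MM then p@_(m - k) else 0.
Proof.
elim/mpolyind: p => [|c m' p _ _ IH]; first by rewrite mulr0 !mcoeff0 if_same.
rewrite mulrDr -scalerAr -mpolyXD !mcoeffD !mcoeffZ IH !mcoeffX.
case: ifP => km; first by rewrite -{1}(submK km) addmC eqm_add2r.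
rewrite addr0; case: eqP => [E|]; last by rewrite mulr0.
by rewrite -E lem_addr in km.
Qed.

Lemma mpoly_mulX_ind (P : Lam n -> Prop) : P 1 ->
  (forall i f, P f -> P ('X_i * f)) ->
  (forall c f g, P f -> P g -> P (c *: f + g)) -> forall f, P f.
Proof.
move=> P1 PX Plin.
have P0 : P 0 by rewrite -(addNr 1) -scaleN1r; apply: Plin.
have PM d m : mdeg m = d -> P 'X_[m].
  elim: d m => [|d IH] m md; first by move/eqP: md; rewrite mdeg_eq0 => /eqP ->; rewrite mpolyX0.
  have [i mi] : exists i, (m i != 0)%N.
    apply/existsP; rewrite -negb_forall; apply/negP => /forallP H.
    have m0 : m == 0%MM by apply/eqP/mnmP => i; rewrite mnm0E; apply/eqP.
    by rewrite -mdeg_eq0 md in m0.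
  have Um : (U_(i) <= m)%MM by rewrite lep1mP.
  rewrite -(submK Um) addmC mpolyXD; apply: PX; apply: IH.
  by apply: succn_inj; rewrite -md -[in RHS](submK Um) mdegD mdeg1 addn1.
by elim/mpolyind => // c m f _ _ Pf; apply: Plin => //; apply: PM.
Qed.

Lemma ev_is_linear : linear (@ev n).
Proof. by move=> c f g; rewrite /ev linearP. Qed.
HB.instance Definition _ :=
  GRing.isLinear.Build F (Lam n) {mpoly F[n]} *:%R (@ev n) ev_is_linear.

Lemma ev1 : ev (1 : Lam n) = 1.
Proof. exact: comp_mpoly1. Qed.

Lemma evX i : ev ('X_i : Lam n) = \sum_(j < n) 'X_j ^+ i.+1.
Proof. by rewrite /ev comp_mpolyXU -tnth_nth tnth_mktuple. Qed.

Lemma evM f g : ev (f * g) = ev f * ev g.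
Proof. by rewrite /ev rmorphM. Qed.

Lemma mderiv_psum i (j : 'I_n) :
  (\sum_(l < n) 'X_l ^+ i.+1 : {mpoly F[n]})^`M(j) = i.+1%:R *: 'X_j ^+ i.
Proof.
rewrite raddf_sum (bigD1 j) //= [X in _ + X]big1 ?addr0 => [|l lj].
  rewrite !mpolyXn mderivX mulmnE mnm1E eqxx mul1n; congr (_ *: 'X_[_]).
  by apply/mnmP => l; rewrite mnmBE !mulmnE mnm1E; case: (j == l); lia.
by rewrite mpolyXn mderivX mulmnE mnm1E (negPf lj) mul0n scale0r.
Qed.

(** The right-hand side of the chain rule, as $\partial p_{i+1}/\partial x_j=(i+1)x_j^i$. *)
Definition ev_deriv f j : {mpoly F[n]} :=
  \sum_(i < n) i.+1%:R *: (ev f^`M(i) * 'X_j ^+ i).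

Lemma ev_derivM f g j : ev_deriv (f * g) j = ev_deriv f j * ev g + ev f * ev_deriv g j.
Proof.
apply: sum_leibniz0 => i; rewrite mderivM linearD /= !evM.
move: (ev f^`M(i)) (ev g^`M(i)) (ev f) (ev g) ('X_j ^+ i) => *.
by rewrite -!mul_mpolyC; ring.
Qed.

Lemma ev_derivX i j : ev_deriv 'X_i j = i.+1%:R *: 'X_j ^+ i.
Proof.
rewrite /ev_deriv (bigD1 i) //= big1 ?addr0 => [|k ki].
  have UU : (U_(i) - U_(i))%MM = 0%MM :> 'X_{1..n}.
    by apply/mnmP => l; rewrite mnmBE mnm0E subnn.
  by rewrite mderivX mnm1E eqxx scale1r UU mpolyX0 ev1 mul1r.
by rewrite mderivX mnm1E eq_sym (negPf ki) scale0r linear0 mul0r scaler0.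
Qed.

Lemma ev_deriv_linear j : linear (ev_deriv^~ j).
Proof.
apply: sum_is_linear => i c f g; rewrite mderivD mderivZ ev_is_linear.
by move: (ev f^`M(i)) (ev g^`M(i)) ('X_j ^+ i) => *; rewrite -!mul_mpolyC; ring.
Qed.

Lemma ev_chain f j : (ev f)^`M(j) = ev_deriv f j.
Proof.
elim/mpoly_mulX_ind: f => [|i f IH|c f g IHf IHg].
- rewrite ev1 -mpolyC1 mderivC /ev_deriv big1 // => i _.
  by rewrite mderivC linear0 mul0r scaler0.
- rewrite evM mderivM ev_derivM; congr (_ * _ + _ * _); last exact: IH.
  by rewrite evX mderiv_psum ev_derivX.
rewrite ev_deriv_linear ev_is_linear mderivD mderivZ.
by congr (_ *: _ + _); [exact: IHf | exact: IHg].
Qed.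

(* Jacobian criterion: if f(p_1, ..., p_n) = 0, the chain rule and the invertibility
   of the Vandermonde matrix show that every partial derivative of f vanishes at
   (p_1, ..., p_n) as well, so f is constant by induction on the degree. *)
Lemma ev_inj : injective (@ev n).
Proof.
suff H d f : (forall m, (d <= mdeg m)%N -> f@_m = 0) -> ev f = 0 -> f = 0.
  move=> f g fg; apply/eqP; rewrite -subr_eq0; apply/eqP.
  apply: (H (msize (f - g))); last by rewrite linearB /= fg subrr.
  by move=> m /msize_mdeg_ge /memN_msupp_eq0.
elim: d f => [|d IH] f fd f0; first by apply/mpolyP => m; rewrite fd // mcoeff0.
have ev_d0 i : ev f^`M(i) = 0.
  pose v : 'rV[{mpoly F[n]}]_n := \row_i (i.+1%:R *: ev f^`M(i)).
  pose V := Vandermonde n (\row_(j < n) ('X_j : {mpoly F[n]})).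
  have vV : v *m V = 0.
    apply/rowP => j; have := ev_chain f j; rewrite f0 mderiv0 !mxE /ev_deriv => E; rewrite [RHS]E.
    by apply: eq_bigr => k _; rewrite !mxE scalerAl.
  have dV : \det V != 0.
    rewrite det_Vandermonde; apply/prodf_neq0 => a _; apply/prodf_neq0 => b ab.
    rewrite !mxE subr_eq0; apply/eqP => /mpolyP /(_ U_(a)%MM) /eqP.
    rewrite !mcoeffX eqxx.
    have -> : (U_(b) == U_(a) :> 'X_{1..n})%MM = false.
      apply/eqP => /mnmP /(_ a); rewrite !mnm1E eqxx.
      by case: eqP => // ba; rewrite ba ltnn in ab.
    by rewrite eq_sym oner_eq0.
  (* Entries are polynomials, so [V] is cancelled through its adjugate, which leaves a nonzero
     determinant in an integral domain. *)
  have : v *m (V *m \adj V) = 0 by rewrite mulmxA vV mul0mx.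
  rewrite mul_mx_adj mul_mx_scalar => /rowP /(_ i) /eqP; rewrite !mxE.
  rewrite mulf_eq0 (negPf dV) /= scaler_eq0 natF_eq0 /=.
  by move/eqP.
have d0 i : f^`M(i) = 0.
  apply: IH (ev_d0 i) => m dm; rewrite mcoeff_mderiv fd ?mul0rn //.
  by rewrite mdegD mdeg1 addn1.
have f_off m : m != 0%MM -> f@_m = 0.
  move=> m0; have [i mi] : exists i, m i != 0%N.
    apply/existsP; rewrite -negb_forall; apply: contra m0 => /forallP H.
    by apply/eqP/mnmP => i; rewrite mnm0E; apply/eqP.
  have := congr1 (mcoeff (m - U_(i))%MM) (d0 i).
  rewrite mcoeff_mderiv submK ?lep1mP // mcoeff0 -mulr_natr => /eqP.
  by rewrite mulf_eq0 natF_eq0 orbF => /eqP.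
have fC : f = (f@_0)%:MP.
  apply/mpolyP => m; rewrite mcoeffC.
  by case: eqVneq => [->|/f_off ->]; rewrite ?mulr1 ?mulr0.
by move/eqP: f0; rewrite fC /ev comp_mpolyC mpolyC_eq0 => /eqP ->.
Qed.

(** The zeros are kept, so positions match variables; they are harmless in $q$ since $Q_0=1$. *)
Definition mseq m : seq nat := [seq m i | i <- enum 'I_n].

Lemma size_mseq m : size (mseq m) = n.
Proof. by rewrite size_map size_enum_ord. Qed.

Lemma nth_mseq m (i : 'I_n) : nth 0%N (mseq m) i = m i.
Proof. by rewrite (nth_map i) ?size_enum_ord // nth_ord_enum. Qed.

Lemma dw_1 k : dw k (1 : Lam n) = 0.
Proof.
case: (pw_dwP n k) => [_ -> //|i ->]; by rewrite dwS -mpolyC1 mderivC.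
Qed.

Lemma dw_qla k s : (k <= n)%N -> (0 < k)%N ->
  (alpha * k%:R) *: dw k (qla n s) = \sum_(j < size s)
     if (k <= nth 0 s j)%N then qla n (set_nth 0%N s j (nth 0%N s j - k)%N) else 0.
Proof.
move=> kn k0; elim: s => [|a s IH].
  by rewrite qla_nil dw_1 scaler0 big_ord0.
rewrite qla_cons dwM scalerDr [X in X + _]scalerAl [X in _ + X]scalerAr IH big_ord_recl /=; congr (_ + _).
  rewrite dw_Q ?kn // scalerA divff ?scale1r; last first.
    by case: k k0 kn IH => // k _ _ _; exact: alphaM_neq0.
  by rewrite /Qsub; case: ifP; rewrite ?mul0r // qla_cons.
rewrite mulr_sumr; apply: eq_bigr => j _.
by rewrite (fun_if (fun x => Qk n a * x)) mulr0 -qla_cons.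
Qed.

Lemma mcoeff0_qla s : (qla n s)@_0 = (all (pred1 0%N) s)%:R.
Proof.
elim: s => [|a s IH] /=; first by rewrite qla_nil mcoeff1 eqxx.
rewrite qla_cons rmorphM /= IH mcoeff_Qk mwt0 invr1.
have -> : pweight (0%MM : 'X_{1..n}) = 0%N.
  by rewrite /pweight big1 // => i _; rewrite mnm0E muln0.
by rewrite [a == _]eq_sym; case: eqP => _ /=; rewrite ?mul1r ?mul0r.
Qed.

(* The q_mu are dual to the monomial functions: adding p_i to a factor of f shifts one
   entry of m on both sides. *)
Lemma scal_qla_ev m f : scal (qla n (mseq m)) f = (ev f)@_m.
Proof.
elim/mpoly_mulX_ind: f m => [|i f IH|c f g IHf IHg] m.
- rewrite scalC -mpolyX0 scalXl mwt0 mulr1 mpolyX0 ev1 mcoeff1 mcoeff0_qla.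
  congr (nat_of_bool _)%:R; rewrite all_map; apply/allP/eqP => [H|-> i _ /=].
    by apply/mnmP => i; rewrite mnm0E; apply/eqP/H; rewrite mem_enum.
  by rewrite mnm0E.
- rewrite scalC scal_mulX scalC -dwS.
  rewrite -scalZl dw_qla // evM evX mulr_suml raddf_sum /= scal_suml.
  rewrite size_mseq; apply: eq_bigr => j _.
  rewrite mpolyXn mcoeffXM nth_mseq.
  have -> : (U_(j) *+ i.+1 <= m)%MM = (i.+1 <= m j)%N.
    apply/mnm_lepP/idP => [/(_ j)|im l]; rewrite mulmnE mnm1E.
      by rewrite eqxx mul1n.
    by case: eqP => [<-|_]; rewrite ?mul1n ?mul0n.
  case: ifP => im; last by rewrite scal0l.
  rewrite -IH; congr (scal (qla _ _) _).
  have jn : (j < size (mseq m))%N by rewrite size_mseq.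
  apply: (@eq_from_nth _ 0%N) => [|l].
    by rewrite size_set_nth (maxn_idPr jn) !size_mseq.
  rewrite size_set_nth (maxn_idPr jn) size_mseq => ln.
  rewrite nth_set_nth /= (nth_mseq m (Ordinal ln)) (nth_mseq (m - _)%MM (Ordinal ln)).
  rewrite mnmBE mulmnE mnm1E -val_eqE /= eq_sym.
  case: eqP => [lj|_]; last by rewrite mul0n subn0.
  by rewrite mul1n; congr (m _ - _)%N; apply: val_inj.
by rewrite scalDr scalZr IHf IHg linearP /= mcoeffD mcoeffZ.
Qed.
End Evaluation.

(** * Dominance order and the moving up operator *)

Section Partitions.
Local Open Scope nat_scope.
Implicit Types (s t la mu nu : seq nat).

Lemma sumn_takeS k s : sumn (take k.+1 s) = sumn (take k s) + nth 0 s k.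
Proof.
elim: s k => [|a s IH] [|k] //=; first by rewrite take0 /= addn0.
by rewrite IH addnA.
Qed.

Lemma dom_leP mu la :
  reflect (forall k, sumn (take k mu) <= sumn (take k la)) (dom_le mu la).
Proof.
apply: (iffP forallP) => [H k|H k]; last exact: H.
have [kl|kl] := ltnP k (size mu + size la).+1; first exact: (H (Ordinal kl)).
by have := H ord_max; rewrite /= !take_oversize //; lia.
Qed.

Lemma dom_le_refl la : dom_le la la.
Proof. exact/dom_leP. Qed.

Lemma dom_le_trans nu mu la : dom_le mu nu -> dom_le nu la -> dom_le mu la.
Proof. by move=> /dom_leP H1 /dom_leP H2; apply/dom_leP => k; apply: leq_trans (H2 k). Qed.

Lemma pos_eq_nth s t : all (leq 1) s -> all (leq 1) t ->
  (forall k, nth 0 s k = nth 0 t k) -> s = t.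
Proof.
move=> /all_nthP ps /all_nthP pt st; apply: (@eq_from_nth _ 0) => // .
case: (ltngtP (size s) (size t)) => // lt.
  by have := pt 0 _ lt; rewrite -st nth_default.
by have := ps 0 _ lt; rewrite st nth_default.
Qed.

Lemma dom_le_anti mu la : is_partition mu -> is_partition la ->
  dom_le mu la -> dom_le la mu -> mu = la.
Proof.
case/andP=> _ pm /andP[_ pl] /dom_leP H1 /dom_leP H2.
have H k : sumn (take k mu) = sumn (take k la) by apply/eqP; rewrite eqn_leq H1 H2.
apply: pos_eq_nth => // k.
by have := H k.+1; rewrite !sumn_takeS H; apply: addnI.
Qed.

Lemma mem_seqs_upto len b s : (s \in seqs_upto len b)
  = (size s <= len) && all (fun x => 0 < x <= b) s.
Proof.
elim: len s => [|len IH] [|a s] //.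
rewrite inE /=; apply/allpairsP/idP => [[[x t] /= [xi ti [-> ->]]]|].
  move: xi ti; rewrite mem_iota IH => xi /andP[st ->] /=.
  by rewrite ltnS st andbT; lia.
case/and3P=> sl ab al; exists (a, s); split=> //=; first by rewrite mem_iota; lia.
by rewrite IH al -ltnS sl.
Qed.

Lemma mem_enum_part n s : (s \in enum_part n) = is_part_of n s.
Proof.
rewrite mem_filter mem_seqs_upto; case: (boolP (is_part_of n s)) => //= /andP[/andP[_ pos] /eqP <-].
elim: s pos => //= a s IH /andP[a0 /IH /andP[sl sa]].
rewrite a0 leq_addr /=; apply/andP; split; first by lia.
by apply/allP => x /(allP sa); lia.
Qed.

Lemma uniq_enum_part n : uniq (enum_part n).
Proof.
apply: filter_uniq; move: {1}n => len; elim: len => //= len IH.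
rewrite andbC allpairs_uniq ?iota_uniq //=; last by move=> [? ?] [? ?] _ _ [-> ->].
by apply/allpairsP => -[[x t] []].
Qed.

Lemma enum_part_partition n s : s \in enum_part n -> is_partition s.
Proof. by rewrite mem_enum_part => /andP[]. Qed.

Lemma enum_part_sumn n s : s \in enum_part n -> sumn s = n.
Proof. by rewrite mem_enum_part => /andP[_ /eqP]. Qed.

Lemma geq_total : total geq. Proof. by move=> x y; apply: leq_total. Qed.
Lemma geq_trans : transitive geq. Proof. by move=> x y z xy yz; apply: leq_trans yz xy. Qed.
Lemma geq_anti : antisymmetric geq.
Proof. by move=> x y; rewrite -eqn_leq eq_sym => /eqP. Qed.

Definition part_of_seq s := sort geq [seq x <- s | 0 < x].

Lemma sumn_filter_pos s : sumn [seq x <- s | 0 < x] = sumn s.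
Proof. by elim: s => //= -[|a] s /= ->. Qed.

Lemma part_of_seqP s : part_of_seq s \in enum_part (sumn s).
Proof.
rewrite mem_enum_part; apply/andP; split; [apply/andP; split|].
- exact/sort_sorted/geq_total.
- by rewrite all_sort filter_all.
by rewrite (perm_sumn (permEl (perm_sort _ _))) sumn_filter_pos.
Qed.

(* The sum of the k largest entries of s is the minimum over c of the bound below,
   which ignores order and zeros; [sumn_take_sorted] exhibits the optimal c. *)
Lemma sumn_take_cap c k s : sumn (take k s) <= k * c + \sum_(x <- s) (x - c).
Proof.
elim: s k => [|a s IH] [|k] //=; rewrite big_cons mulSn.
by have := IH k; lia.
Qed.

Lemma sumn_take_sorted k s : sorted geq s ->
  k * nth 0 s k + \sum_(x <- s) (x - nth 0 s k) <= sumn (take k s).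
Proof.
elim: s k => [|a s IH] k /=; first by rewrite big_nil nth_nil; lia.
rewrite (path_sortedE geq_trans) => /andP[/allP sa ss].
rewrite big_cons; case: k => [|k] /=.
  rewrite subnn big_seq big1 // => x /sa /= xa; apply/eqP; exact: xa.
have := IH k ss.
have : nth 0 s k <= a.
  by case: (ltnP k (size s)) => ks; [apply: sa; exact: mem_nth | rewrite nth_default].
by rewrite mulSn; lia.
Qed.

Lemma sumn_take_part k s : sumn (take k s) <= sumn (take k (part_of_seq s)).
Proof.
set t := part_of_seq s.
have st : sorted geq t by apply/sort_sorted/geq_total.
apply: leq_trans (sumn_take_sorted k st).
apply: leq_trans (sumn_take_cap (nth 0 t k) k s) _; rewrite leq_add2l.
rewrite (perm_big _ (permEl (perm_sort _ _))) big_filter [X in _ <= X]big_mkcond.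
by apply: leq_sum => -[|x].
Qed.

Lemma nth_mv s i j k l : i < j ->
  nth 0 (mv s i j k) l = if l == j then nth 0 s j - k
                         else if l == i then nth 0 s i + k else nth 0 s l.
Proof. by move=> ij; rewrite /mv nth_set_nth /= nth_set_nth. Qed.

Lemma sumn_take_mv s i j k l : i < j -> k <= nth 0 s j ->
  sumn (take l (mv s i j k)) + (if j < l then k else 0)
  = sumn (take l s) + (if i < l then k else 0).
Proof.
move=> ij kj; elim: l => [|l IH]; first by rewrite !take0.
move: IH; rewrite !sumn_takeS nth_mv // !ltnS.
by case: (ltngtP j l) => lj; case: (ltngtP i l) => li; try subst l; lia.
Qed.

Lemma sumn_mv s i j k : i < j < size s -> k <= nth 0 s j -> sumn (mv s i j k) = sumn s.
Proof.
case/andP=> ij js kj.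
have := @sumn_take_mv s i j k (size s + size (mv s i j k)) ij kj.
rewrite !take_oversize ?leq_addr ?leq_addl //.
by rewrite !ifT; lia.
Qed.

(** Removed values stand on one side and new ones on the other, which avoids truncated
    subtraction. *)
Lemma count_mv p s i j k : i < j < size s ->
  count p (mv s i j k) + p (nth 0 s i) + p (nth 0 s j)
  = count p s + p (nth 0 s i + k) + p (nth 0 s j - k).
Proof.
case/andP=> ij js; have is_ : i < size s by lia.
rewrite /mv count_set_nth_ltn; last by rewrite size_set_nth; lia.
rewrite count_set_nth_ltn // nth_set_nth /= gtn_eqF //.
have ci : p (nth 0 s i) + p (nth 0 s j) <= count p s.
  have -> : count p s = \sum_(l < size s) p (nth 0 s l).
    by rewrite -sum1_count big_mkcond (big_nth 0) big_mkord; apply: eq_bigr => l _; case: p.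
  rewrite (bigD1 (Ordinal is_)) // (bigD1 (Ordinal js)) /=; first by rewrite addnA leq_addr.
  by rewrite -val_eqE /=; apply/eqP; lia.
lia.
Qed.

Lemma moveupE s i j k : moveup s i j k = part_of_seq (mv s i j k).
Proof. by []. Qed.

Lemma moveup_dom s i j k : i < j -> k <= nth 0 s j -> dom_le s (moveup s i j k).
Proof.
move=> ij kj; apply/dom_leP => l; rewrite moveupE; apply: leq_trans (sumn_take_part _ _).
by have := @sumn_take_mv s i j k l ij kj; case: (ltnP j l); case: (ltnP i l); lia.
Qed.

Lemma moveup_enum n s i j k : i < j < size s -> k <= nth 0 s j -> sumn s = n ->
  moveup s i j k \in enum_part n.
Proof. by move=> ij kj <-; rewrite -(sumn_mv ij kj) moveupE part_of_seqP. Qed.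

Lemma count_moveup x s i j k : 0 < x -> i < j < size s ->
  count_mem x (moveup s i j k) + (nth 0 s i == x) + (nth 0 s j == x)
  = count_mem x s + (nth 0 s i + k == x) + (nth 0 s j - k == x).
Proof.
move=> x0 ij; rewrite -(count_mv (pred1 x) k ij) moveupE; congr (_ + _ + _).
rewrite (permP (permEl (perm_sort _ _))) count_filter; apply: eq_count => y /=.
by case: eqP => // ->; rewrite x0.
Qed.

(** The value $s_i+k$ gains an occurrence and, exceeding both $s_i$ and $s_j$, loses none. *)
Lemma moveup_neq s i j k : i < j < size s -> 0 < k <= nth 0 s j ->
  nth 0 s j <= nth 0 s i -> moveup s i j k != s.
Proof.
move=> ij kj ji; apply/eqP => E.
have := @count_moveup (nth 0 s i + k) s i j k; rewrite E eqxx => /(_ _ ij).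
by do 3 (case: eqP => /=); lia.
Qed.

(* {nu_i + k, nu_j - k} and {nu_i, nu_j} are disjoint, so both can be read off the
   multiset difference of the two partitions. *)
Lemma moveup_inj s i j k i' j' k' :
  i < j < size s -> 0 < k <= nth 0 s j -> nth 0 s j <= nth 0 s i ->
  i' < j' < size s -> 0 < k' <= nth 0 s j' -> nth 0 s j' <= nth 0 s i' ->
  moveup s i j k = moveup s i' j' k' ->
  [/\ nth 0 s i = nth 0 s i', nth 0 s j = nth 0 s j' & k = k'].
Proof.
move=> ij kj ji ij' kj' ji' E.
have H x : 0 < x -> _ := fun x0 => count_moveup k x0 ij.
have H' x : 0 < x -> _ := fun x0 => count_moveup k' x0 ij'.
rewrite E in H.
move: (nth 0 s i) (nth 0 s j) (nth 0 s i') (nth 0 s j') H H' kj ji kj' ji'.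
move=> a b a' b' H H' kb ba kb' ba'.
have in_count (l l' : seq nat) x :
    count_mem x l = count_mem x l' -> (x \in l) = (x \in l').
  by move=> E'; rewrite -!has_pred1 !has_count E'.
have {H H' E} H x : 0 < x ->
    count_mem x [:: a + k; b - k; a'; b'] = count_mem x [:: a' + k'; b' - k'; a; b].
  move=> x0; have := H x x0; have := H' x x0; rewrite /=.
  move: (count_mem x s) (count_mem x (moveup s i' j' k')) => c d.
  move: (nat_of_bool (a + k == x)) (nat_of_bool (b - k == x)).
  move: (nat_of_bool (a == x)) (nat_of_bool (b == x)) => ? ? ? ?.
  move: (nat_of_bool (a' + k' == x)) (nat_of_bool (b' - k' == x)).
  by move: (nat_of_bool (a' == x)) (nat_of_bool (b' == x)) => *; lia.
have ak : a + k = a' + k'.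
  have ak0 : 0 < a + k by lia.
  have ak0' : 0 < a' + k' by lia.
  have := in_count _ _ _ (H _ ak0); have := in_count _ _ _ (H _ ak0').
  rewrite !inE !eqxx /= => /or4P h1 /esym/or4P h2.
  by case: h1 => /eqP h1; case: h2 => /eqP h2; lia.
have {}H x : 0 < x -> count_mem x [:: b - k; a'; b'] = count_mem x [:: b' - k'; a; b].
  by move=> /H /=; rewrite ak => /addnI.
have aa : a = a'.
  have a0 : 0 < a by lia.
  have a0' : 0 < a' by lia.
  have := in_count _ _ _ (H _ a0); have := in_count _ _ _ (H _ a0').
  rewrite !inE !eqxx ?orbT => /esym/or3P h1 /or3P h2.
  by case: h1 => /eqP h1; case: h2 => /eqP h2; lia.
have kk : k = k' by lia.
have {}H x : 0 < x -> count_mem x [:: b - k; b'] = count_mem x [:: b' - k; b].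
  by move=> /H /=; rewrite aa kk addnCA [X in _ = X]addnCA => /addnI.
have b0 : 0 < b by lia.
have b0' : 0 < b' by lia.
have := in_count _ _ _ (H _ b0); have := in_count _ _ _ (H _ b0').
rewrite !inE !eqxx ?orbT => /esym/orP h1 /orP h2.
by split=> //; case: h1 => /eqP h1; case: h2 => /eqP h2; lia.
Qed.

Lemma moveup_eq s i j k i' j' :
  i < j < size s -> i' < j' < size s ->
  nth 0 s i = nth 0 s i' -> nth 0 s j = nth 0 s j' ->
  moveup s i j k = moveup s i' j' k.
Proof.
move=> ij ij' Ei Ej; rewrite !moveupE /part_of_seq.
apply/(perm_sortP geq_total geq_trans geq_anti); apply: perm_filter.
apply/permP => p; have := count_mv p k ij.
by rewrite Ei Ej -(count_mv p k ij') => /addIn/addIn.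
Qed.

Definition nsum s := \sum_(i < size s) i.+1 * nth 0 s i.

(* Abel summation: [nsum] is strictly decreasing for the dominance order. *)
Lemma nsum_abel s N : size s <= N ->
  \sum_(k < N) sumn (take k s) + nsum s = N * sumn s.
Proof.
elim: s N => [|a s IH] N /=.
  by move=> _; rewrite /nsum big_ord0 big1 ?muln0.
case: N => // N sN; rewrite big_ord_recl /nsum big_ord_recl /=.
have -> : \sum_(i < N) sumn (take (bump 0 i) (a :: s)) = N * a + \sum_(i < N) sumn (take i s).
  rewrite -[X in X * a]card_ord -sum_nat_const -big_split; apply: eq_bigr => i _ //.
have -> : \sum_(i < size s) (bump 0 i).+1 * nth 0 s i = nsum s + sumn s.
  rewrite sumnE (big_nth 0) big_mkord -big_split; apply: eq_bigr => i _ /=.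
  by rewrite /bump /= add1n mulSn addnC.
have := IH N sN; rewrite /=; lia.
Qed.

(** Equal [nsum] forces equal totals of the partial sums; these being ordered termwise, they all
    agree. *)
Lemma dom_le_nsum n mu la : mu \in enum_part n -> la \in enum_part n ->
  dom_le mu la -> nsum mu = nsum la -> mu = la.
Proof.
move=> mun lan H E; have HS := elimT (dom_leP _ _) H.
apply: dom_le_anti (enum_part_partition mun) (enum_part_partition lan) H _.
set N := size mu + size la.
have Hm := @nsum_abel mu N (leq_addr _ _); have Hl := @nsum_abel la N (leq_addl _ _).
rewrite (enum_part_sumn mun) E in Hm; rewrite (enum_part_sumn lan) in Hl.
have ES : \sum_(k < N) sumn (take k mu) = \sum_(k < N) sumn (take k la) by lia.
have := @leqif_sum 'I_N predT (fun k => sumn (take k mu) == sumn (take k la))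
  (fun k => sumn (take k mu)) (fun k => sumn (take k la)).
case=> [k _|_]; first by split.
rewrite ES eqxx => /esym/forallP T; apply/dom_leP => k.
have [kN|kN] := ltnP k N; first by have := T (Ordinal kN) => /eqP ->.
by rewrite !take_oversize ?(enum_part_sumn mun) ?(enum_part_sumn lan) //; lia.
Qed.

End Partitions.

(** * Multiplicities of moves and the coefficients $r_{\nu\mu}$ *)

Lemma big_iota0 (V : nmodType) N (G : nat -> V) (p : pred nat) :
  \sum_(i <- iota 0 N | p i) G i = \sum_(i < N | p i) G i.
Proof. by rewrite -(subn0 N) -/(index_iota 0 N) big_mkord subn0. Qed.

Lemma sum_move_triples (V : nmodType) nu (G : nat * nat * nat -> V) :
  \sum_(t <- move_triples nu) G t
  = \sum_(i < size nu) \sum_(j < size nu | (i < j)%N) \sum_(k < nth 0%N nu j)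
      G (i : nat, j : nat, k.+1).
Proof.
rewrite /move_triples big_filter big_flatten /= big_allpairs_dep.
rewrite big_iota0; apply: eq_bigr => i _; rewrite big_iota0 [RHS]big_mkcond; apply: eq_bigr => j _ /=.
rewrite big_map /valid_move /=; case: ltnP => ij /=; last by rewrite big_pred0_eq.
have jN : (nth 0%N nu j <= sumn nu)%N.
  by rewrite sumnE (big_nth 0%N) big_mkord (bigD1 j) //= leq_addr.
rewrite ltn_ord /= (iotaDl 1 0) big_map.
rewrite big_iota0.
rewrite (eq_bigl (fun k : 'I_(sumn nu) => (k < nth 0%N nu j)%N)) => [|k].
  by rewrite (big_ord_narrow jN).
by rewrite add1n.
Qed.

Lemma mem_move_triples nu i j k :
  ((i, j, k) \in move_triples nu)
  = [&& (i < j < size nu)%N & (0 < k <= nth 0%N nu j)%N].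
Proof.
rewrite mem_filter /valid_move; apply/andP/andP.
  by case=> /and4P[-> -> -> ->] _.
case=> /andP[ij js] /andP[k0 kj]; split; first by rewrite ij js k0 kj.
apply/flattenP; exists [seq (i, j, k) | k <- iota 1 (sumn nu)].
  by apply/allpairsP; exists (i, j); rewrite !mem_iota /= !add0n js (ltn_trans ij js).
apply/mapP; exists k => //; rewrite mem_iota k0 add1n ltnS (leq_trans kj) //.
by rewrite sumnE (big_nth 0%N) big_mkord (bigD1 (Ordinal js)) //= leq_addr.
Qed.

(** The number of pairs of positions $i<j$ carrying the values $a$ and $b$; it is the multiplicity
    inside $r_{\nu\mu}$. *)
Definition count_pairs (a b : nat) (s : seq nat) : nat :=
  (\sum_(i < size s) \sum_(j < size s | i < j) (nth 0 s i == a) * (nth 0 s j == b))%N.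

Lemma count_pairs_cons a b x s :
  count_pairs a b (x :: s) = ((x == a) * count_mem b s + count_pairs a b s)%N.
Proof.
rewrite /count_pairs big_ord_recl /= big_mkcond big_ord_recl /= add0n; congr (_ + _)%N.
  rewrite -sum1_count big_mkcond (big_nth 0%N) big_mkord big_distrr /=.
  rewrite [RHS]big_mkcond; apply: eq_bigr => j _ /=.
  by rewrite add0n; case: (nth _ _ _ == b); rewrite ?muln0.
apply: eq_bigr => i _; rewrite big_mkcond big_ord_recl /= add0n [RHS]big_mkcond.
by apply: eq_bigr => j _; rewrite /bump /= !add1n ltnS.
Qed.

Lemma count_pairs_diag a s : (count_pairs a a s).*2 = (count_mem a s * (count_mem a s).-1)%N.
Proof.
elim: s => [|x s IH]; first by rewrite /count_pairs big_ord0.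
rewrite count_pairs_cons doubleD IH /=; case: eqP => _; last by rewrite mul0n !add0n.
by rewrite mul1n add1n /=; case: (count_mem a s) => //= c; nia.
Qed.

(** In a decreasing list every $a$ precedes every $b$, so any two occurrences form a pair. *)
Lemma count_pairs_lt a b s : sorted geq s -> (b < a)%N ->
  count_pairs a b s = (count_mem a s * count_mem b s)%N.
Proof.
move=> + ba; elim: s => [|x s IH]; first by rewrite /count_pairs big_ord0.
rewrite /= (path_sortedE geq_trans) => /andP[/allP sx /IH {}IH].
rewrite count_pairs_cons IH /=; case: (eqVneq x a) => [->|xa].
  by rewrite gtn_eqF // mul1n !add0n mulSn.
case: (eqVneq x b) => [xb|xb]; last by rewrite mul0n !add0n.
have -> : count_mem a s = 0%N by apply/count_memPn/negP => /sx /=; lia.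
by [].
Qed.

Lemma sorted_geq_nth s i j : sorted geq s -> (i < j < size s)%N ->
  (nth 0 s j <= nth 0 s i)%N.
Proof.
move=> ss /andP[ij js]; apply: (sorted_leq_nth geq_trans _ 0%N ss) => //.
- by move=> x; apply: leqnn.
- by rewrite inE; lia.
- exact: ltnW.
Qed.

(** By [moveup_inj] all moves from [nu] to [mu] share the values $a$, $b$ and the amount $k$; by
    [moveup_eq] every pair of positions with these values gives such a move. So the sum is one
    coefficient times [count_pairs], and the triple picked by [r_coef] does not matter. *)
Lemma r_coefE nu mu : is_partition nu ->
  \sum_(t <- move_triples nu | let: (i, j, k) := t in moveup nu i j k == mu)
     (let: (i, j, k) := t in mv_coef nu i j k)
  = if in_Mup nu mu then r_coef nu mu else 0.
Proof.
case/andP=> snu _.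
pose isup (t : nat * nat * nat) := let: (i, j, k) := t in moveup nu i j k == mu.
rewrite /in_Mup -/isup -[X in \sum_(t <- _ | X t) _]/isup.
case: ifPn => [up|/hasPn noup]; last first.
  by rewrite big_seq_cond big_pred0 // => t; apply/andP => -[/noup/negP].
rewrite /r_coef -/isup.
set u := nth _ _ 0.
have : u \in [seq t <- move_triples nu | isup t].
  by rewrite mem_nth // size_filter -has_count.
case: u => [[i0 j0] k0]; rewrite mem_filter mem_move_triples => /and3P[/eqP up0 ij0 k0b].
set a := nth 0%N nu i0; set b := nth 0%N nu j0.
have ba : (b <= a)%N by apply: sorted_geq_nth.
transitivity ((count_pairs a b nu)%:R * mv_coef nu i0 j0 k0).
  rewrite big_mkcond sum_move_triples /count_pairs natr_sum mulr_suml.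
  apply: eq_bigr => i _; rewrite natr_sum mulr_suml; apply: eq_bigr => j ij.
  have ijs : (i < j < size nu)%N by rewrite ij ltn_ord.
  have inj (k : 'I_(nth 0%N nu j)) : moveup nu i j k.+1 == mu ->
      [/\ nth 0%N nu i = a, nth 0%N nu j = b & k.+1 = k0].
    rewrite -up0 => /eqP; apply: moveup_inj => //; first by rewrite ltn_ord.
    exact: sorted_geq_nth.
  have [/andP[/eqP ia /eqP jb]|iajb] := boolP ((nth 0 nu i == a) && (nth 0 nu j == b))%N;
      last first.
    rewrite mulnb (negPf iajb) mul0r big1 // => k _ /=.
    by case: ifP => // /inj[ia jb _]; rewrite ia jb !eqxx in iajb.
  have -> : ((nth 0 nu i == a) * (nth 0 nu j == b) = 1)%N by rewrite ia jb !eqxx.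
  rewrite mul1r.
  (* At such a pair of positions exactly one amount reaches [mu]; the summation index is that amount
     minus one. *)
  have k0j : (k0.-1 < nth 0 nu j)%N by rewrite jb prednK; case/andP: k0b.
  have k0E : k0.-1.+1 = k0 by rewrite prednK //; case/andP: k0b.
  rewrite (bigD1 (Ordinal k0j)) //= k0E (moveup_eq k0 ijs ij0) // up0 eqxx.
  rewrite big1 ?addr0 => [|k kk].
    by rewrite /mv_coef ia jb.
  case: ifP => // /inj[_ _ kE]; case/eqP: kk; apply: val_inj => /=.
  by rewrite -kE.
rewrite /mv_coef -/a -/b /mult; congr (_ * _).
case: (eqVneq a b) => [ab|ab].
  (* For equal values there are $m(m-1)/2$ pairs; doubling both sides removes the
     $(1+\delta)^{-1}$. *)
  have two0 : 1 + 1 != 0 :> F by have := natF_eq0 2; rewrite mulr2n => ->.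
  apply: (mulfI two0); rewrite -ab !mulrA mulfV // mul1r.
  have := count_pairs_diag a nu; rewrite -addnn => /(congr1 (fun x => x%:R : F)).
  rewrite natrD natrM; case: (count_mem a nu) => [|c].
    by rewrite !mul0r => E; rewrite mulrDl mul1r.
  have -> : c.+1%:R - true%:R = c%:R :> F by rewrite -natr1 addrK.
  by move=> <-; rewrite mulrDl mul1r.
rewrite count_pairs_lt //; last by rewrite ltn_neqAle eq_sym ab ba.
by rewrite addr0 invr1 mul1r subr0 natrM.
Qed.

(** * Eigenvalues and their separation *)

Lemma half_shift (K : fieldType) (c x y z : K) : 2%:R != 0 :> K ->
  (c * x - y) / 2%:R - z = c / 2%:R * x - (z + y) + y / 2%:R.
Proof. by move=> h2; field. Qed.

Lemma double_eq (K : fieldType) (c x y a b : K) : 2%:R != 0 :> K ->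
  c / 2%:R * x - a - (c / 2%:R * y - b) = 0 -> c * x + 2%:R * b = c * y + 2%:R * a.
Proof.
move=> h2 /(congr1 (fun z => 2%:R * z)); rewrite mulr0 => E.
by apply/eqP; rewrite -subr_eq0 -E; apply/eqP; field.
Qed.

Lemma eprimeE s : eprime s = alpha / 2%:R * (\sum_(x <- s) x ^ 2)%N%:R - (nsum s)%:R.
Proof. by rewrite /eprime /nsum !natr_sum. Qed.

(* On partitions of n the shift is constant, so it disappears from differences. *)
Lemma eigenE s : eigen s = eprime s + (sumn s)%:R / 2%:R.
Proof.
have nsumE : nsum s = (\sum_(i < size s) i * nth 0 s i + sumn s)%N.
  rewrite /nsum sumnE (big_nth 0%N) big_mkord -big_split.
  by apply: eq_bigr => i _; rewrite mulSn addnC.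
rewrite eprimeE /eigen nsumE -natr_sum natrD.
have -> : \sum_(x <- s) eps x = (alpha * (\sum_(x <- s) x ^ 2)%N%:R - (sumn s)%:R) / 2%:R.
  by rewrite /eps -mulr_suml sumrB -mulr_sumr -!natr_sum sumnE.
by apply: half_shift; rewrite natF_eq0.
Qed.

(** [alpha] is an indeterminate: both sides are polynomials in it, and their constant terms are
    compared. *)
Lemma alphaD_inj (a b c d : nat) :
  alpha * a%:R + b%:R = alpha * c%:R + d%:R -> b = d.
Proof.
rewrite /alpha -!(rmorph_nat (@tofrac {poly rat})) -!rmorphM -!rmorphD /=.
move/eqP; rewrite tofrac_eq => /eqP /(congr1 (fun p : {poly rat} => p`_0)).
rewrite !coefD !coefXM /= !add0r -!polyC_natr !coefC /= => /eqP.
by rewrite Num.Theory.eqr_nat => /eqP.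
Qed.

(* The difference is A alpha - B with rational A, B, and B <> 0. *)
Lemma eprime_neq n la mu : la \in enum_part n -> mu \in enum_part n ->
  dom_lt la mu -> eprime la - eprime mu != 0.
Proof.
move=> lan mun /andP[ll /eqP lm]; apply/eqP => E; apply: lm.
apply: dom_le_nsum lan mun ll _.
move: E; rewrite !eprimeE.
move: (\sum_(x <- la) _)%N (\sum_(x <- mu) _)%N => x y E.
suff /alphaD_inj : alpha * x%:R + (2 * nsum mu)%N%:R = alpha * y%:R + (2 * nsum la)%N%:R by lia.
by rewrite !natrM; apply: double_eq E; rewrite natF_eq0.
Qed.

Section MovingUp.
Variable n : nat.

Lemma qla_part_of_seq s : qla n (part_of_seq s) = qla n s.
Proof.
rewrite /Defs.qla (perm_big _ (permEl (perm_sort _ _))) big_filter big_mkcond /=.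
by apply: eq_bigr => -[|x] _ //; rewrite Qk_0.
Qed.

(** The moves of [DL_qla] are grouped by the partition they produce; [r_coefE] sums each group. *)
Lemma DL_qla_enum nu : nu \in enum_part n ->
  DL (qla n nu) = eigen nu *: qla n nu
    + \sum_(mu <- enum_part n | in_Mup nu mu) r_coef nu mu *: qla n mu.
Proof.
move=> nun; have pnu := enum_part_partition nun; have sn := enum_part_sumn nun.
rewrite DL_qla ?sn //; congr (_ + _).
pose G t := let: (i, j, k) := t in mv_coef nu i j k *: qla n (mv nu i j k) : Lam n.
rewrite -(sum_move_triples nu G).
transitivity (\sum_(mu <- enum_part n) \sum_(t <- move_triples nu |
    let: (i, j, k) := t in moveup nu i j k == mu) G t).
  rewrite (exchange_big_dep predT) //= [LHS]big_seq [RHS]big_seq.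
  apply: eq_bigr => -[[i j] k]; rewrite mem_move_triples => /andP[ij /andP[k0 kj]].
  have mn := moveup_enum ij kj sn.
  rewrite -big_filter.
  have -> : [seq mu <- enum_part n | moveup nu i j k == mu] = [:: moveup nu i j k].
    rewrite (eq_filter (a2 := pred1 (moveup nu i j k))); last by move=> x; rewrite /= eq_sym.
    by rewrite filter_pred1_uniq // uniq_enum_part.
  by rewrite big_seq1.
rewrite [RHS]big_mkcond; apply: eq_bigr => mu _.
transitivity ((\sum_(t <- move_triples nu | let: (i, j, k) := t in moveup nu i j k == mu)
     (let: (i, j, k) := t in mv_coef nu i j k)) *: qla n mu).
  rewrite scaler_suml; apply: eq_bigr => -[[i j] k] /eqP <-.
  by rewrite /G moveupE qla_part_of_seq.
by rewrite r_coefE //; case: ifP => // _; rewrite scale0r.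
Qed.

End MovingUp.

(** * Jack functions *)

Lemma exists_min (T : eqType) (s : seq T) (h : T -> nat) : s != [::] ->
  exists2 x, x \in s & forall y, y \in s -> (h x <= h y)%N.
Proof.
elim: s => // a [|b s] IH _; first by exists a; rewrite ?mem_seq1 // => y /[!inE] /eqP ->.
have [x xs xmin] := IH isT; have [ax|xa] := leqP (h a) (h x).
  exists a; rewrite ?mem_head // => y /[!(in_cons a)] /predU1P[->//|/xmin].
  exact: leq_trans.
exists x; first by rewrite in_cons xs orbT.
by move=> y /[!(in_cons a)] /predU1P[->|/xmin //]; exact: ltnW.
Qed.

Lemma size_enum_part n s : s \in enum_part n -> (size s <= n)%N.
Proof. by rewrite mem_filter mem_seqs_upto => /and3P[]. Qed.

Lemma nsum_le n s : s \in enum_part n -> (nsum s <= n * n)%N.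
Proof.
move=> sn; have := nsum_abel (size_enum_part sn); rewrite (enum_part_sumn sn) => <-.
exact: leq_addl.
Qed.

(** This makes [nsum] a rank function: extremal values of [nsum] select dominance-extremal
    partitions. *)
Lemma nsum_lt n mu la : mu \in enum_part n -> la \in enum_part n ->
  dom_le mu la -> mu != la -> (nsum la < nsum mu)%N.
Proof.
move=> mun lan ml neq; rewrite ltn_neqAle; apply/andP; split.
  by apply: contra neq => /eqP E; apply/eqP/(dom_le_nsum mun lan ml).
have Em := nsum_abel (size_enum_part mun); have El := nsum_abel (size_enum_part lan).
rewrite (enum_part_sumn mun) in Em; rewrite (enum_part_sumn lan) -Em in El.
have H : (\sum_(k < n) sumn (take k mu) <= \sum_(k < n) sumn (take k la))%N.
  by apply: leq_sum => k _; move/dom_leP: ml.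
by rewrite -(leq_add2l (\sum_(k < n) sumn (take k la))) El leq_add2r.
Qed.

Lemma in_Mup_dom nu mu : in_Mup nu mu -> dom_le nu mu.
Proof.
case/hasP => -[[i j] k]; rewrite mem_move_triples => /andP[/andP[ij _] /andP[_ kj]] /eqP <-.
exact: moveup_dom.
Qed.

Lemma in_Mup_neq nu mu : is_partition nu -> in_Mup nu mu -> mu != nu.
Proof.
case/andP=> snu _ /hasP[[[i j] k]]; rewrite mem_move_triples => /andP[ij k0] /eqP <-.
exact: moveup_neq (sorted_geq_nth snu ij).
Qed.

(** * Weight grading and nondegeneracy *)

Section Weights.
Variable n : nat.
Implicit Types (f g : Lam n) (m : 'X_{1..n}).

Lemma sumn_mseq m : sumn (mseq m) = mdeg m.
Proof. by rewrite sumnE big_map big_enum mdegE. Qed.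

Lemma mcoeff_msymm mu m : (msymm n mu)@_m = (part_of_seq (mseq m) == mu)%:R.
Proof.
rewrite /msymm raddf_sum /=.
have [pm|pm] := eqVneq (part_of_seq (mseq m)) mu; last first.
  rewrite big1 // => m' /eqP pm'; rewrite mcoeffX; case: eqP => // mm.
  by case/eqP: pm; rewrite -mm; exact: pm'.
have ms : (mdeg m < (sumn mu).+1)%N.
  by rewrite ltnS -pm (enum_part_sumn (part_of_seqP _)) sumn_mseq.
rewrite (bigD1 (BMultinom ms)) /=; last by rewrite -[X in X == _]/(part_of_seq (mseq m)) pm.
rewrite mcoeffX eqxx big1 ?addr0 // => m' /andP[_ m'm]; rewrite mcoeffX.
by case: eqP => // mm; case/eqP: m'm; apply: val_inj.
Qed.

(** A partition of $n$ has at most $n$ parts, so padding with zeros turns it into an exponent vector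
    in $n$ variables. *)
Lemma part_of_seq_surj mu : mu \in enum_part n ->
  exists m, part_of_seq (mseq m) = mu.
Proof.
move=> mun; have sz := size_enum_part mun.
have /andP[smu pmu] := enum_part_partition mun.
exists [multinom nth 0%N mu i | i < n].
have -> : mseq [multinom nth 0%N mu i | i < n] = mu ++ nseq (n - size mu) 0%N.
  apply: (@eq_from_nth _ 0%N); first by rewrite size_mseq size_cat size_nseq subnKC.
  move=> i; rewrite size_mseq => i_n; rewrite (nth_mseq _ (Ordinal i_n)) mnmE nth_cat /=.
  by case: ltnP => // si; rewrite nth_nseq if_same nth_default.
rewrite /part_of_seq filter_cat (_ : [seq x <- nseq _ _ | _] = [::]) ?cats0; last first.
  by apply/eqP; rewrite -(negbK (_ == _)) -has_filter has_nseq ltnn andbF.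
by rewrite (all_filterP pmu) (sorted_sort geq_trans smu).
Qed.

Lemma scal_qpart m f : scal (qla n (part_of_seq (mseq m))) f = (ev f)@_m.
Proof. by rewrite qla_part_of_seq scal_qla_ev. Qed.

Definition pwhom w f := forall m, f@_m != 0 -> pweight m = w.

Lemma pweightD m m' : pweight (m + m') = (pweight m + pweight m')%N.
Proof.
by rewrite /pweight -big_split; apply: eq_bigr => i _; rewrite mnmDE mulnDr.
Qed.

Lemma pwhom_qla s : pwhom (sumn s) (qla n s).
Proof.
elim: s => [|a s IH] m /=.
  rewrite qla_nil mcoeff1; have [-> _|_] := eqVneq m 0%MM; last by rewrite eqxx.
  by rewrite /pweight big1 // => i _; rewrite mnm0E muln0.
rewrite qla_cons -mcoeff_msupp => /msuppM_le /allpairsP[[m1 m2] /= [h1 h2 ->]].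
rewrite pweightD; congr (_ + _)%N; last by apply: IH; rewrite -mcoeff_msupp.
move: h1; rewrite mcoeff_msupp mcoeff_Qk.
by have [//|_] := eqVneq (pweight m1) a; rewrite eqxx.
Qed.

Definition pwproj w f : Lam n :=
  \sum_(m <- msupp f | pweight m == w) f@_m *: 'X_[m].

Lemma mcoeff_pwproj w f m : (pwproj w f)@_m = if pweight m == w then f@_m else 0.
Proof.
rewrite /pwproj raddf_sum /= (eq_bigr (fun k => if k == m then f@_m else 0)); last first.
  move=> k _; rewrite mcoeffZ mcoeffX; case: eqP => [->|_]; by rewrite ?mulr1 ?mulr0.
rewrite -big_mkcondr /=; case: (boolP (m \in msupp f)) => [mf|mf].
  rewrite -big_filter.
  have -> : [seq k <- msupp f | pweight k == w & k == m] = if pweight m == w then [:: m] else [::].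
    rewrite filter_predI filter_pred1_uniq //=; exact: msupp_uniq.
  by case: ifP; rewrite ?big_seq1 ?big_nil.
rewrite (memN_msupp_eq0 mf) if_same big1 // .
Qed.

Lemma scal_pwproj w f g : pwhom w g -> scal g (pwproj w f) = scal g f.
Proof.
move=> gw; apply: eq_big_seq => m; rewrite mcoeff_msupp => /gw mw.
by rewrite mcoeff_pwproj mw eqxx.
Qed.

Lemma scal_pwproj0 w w' f g : pwhom w' g -> w' != w -> scal g (pwproj w f) = 0.
Proof.
move=> gw ww; rewrite /scal big_seq big1 // => m; rewrite mcoeff_msupp => /gw mw.
by rewrite mcoeff_pwproj mw (negPf ww) mulr0 !mul0r.
Qed.

(** Evaluation carries weight in the $p_k$ to degree in the $x_j$. Duality gives this at once: the
    coefficient at [m] is a scalar product with a $q$ of weight [mdeg m]. *)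
Lemma mcoeff_ev_pwproj w f m :
  (ev (pwproj w f))@_m = if mdeg m == w then (ev f)@_m else 0.
Proof.
have := @pwhom_qla (mseq m); rewrite sumn_mseq => H.
apply: etrans (esym (scal_qla_ev m (pwproj w f))) _.
rewrite -[X in if _ then X else _](scal_qla_ev m f).
case: eqP => [mw|/eqP mw]; last exact: scal_pwproj0 H mw.
by rewrite scal_pwproj -?mw.
Qed.

(** Nondegeneracy in weight $n$: by duality the degree-$n$ part of [ev f] vanishes, hence by
    [ev_inj] the weight-$n$ part of [f]. *)
Lemma scal_kill f g : pwhom n g ->
  (forall mu, mu \in enum_part n -> scal (qla n mu) f = 0) -> scal g f = 0.
Proof.
move=> gn fq; rewrite -(scal_pwproj _ gn).
suff -> : pwproj n f = 0 by rewrite scal0r.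
apply: (@ev_inj n); apply/mpolyP => m.
rewrite linear0 mcoeff0 mcoeff_ev_pwproj; case: eqP => // mn.
by rewrite -scal_qpart fq // -[in X in enum_part X]mn -sumn_mseq part_of_seqP.
Qed.

End Weights.

(** * Triangularity and the recursion *)

Lemma scal_add_sum n (e : F) (q p : Lam n) (I : Type) (r : seq I) (B : pred I)
    (c : I -> F) (G : I -> Lam n) :
  scal (e *: q + \sum_(i <- r | B i) c i *: G i) p
  = e * scal q p + \sum_(i <- r | B i) c i * scal (G i) p.
Proof.
by rewrite scalDl scalZl scal_suml; congr (_ + _); apply: eq_bigr => i _; rewrite scalZl.
Qed.

Lemma DLZ n c (f : Lam n) : DL (c *: f) = c *: DL f.
Proof. exact: linearZ. Qed.

Lemma scale_add_sum n (a b e : F) (q : Lam n) (I : Type) (r : seq I) (B : pred I)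
    (c : I -> F) (G : I -> Lam n) :
  a *: (e *: q + \sum_(i <- r | B i) c i *: G i) - b *: (a *: q)
  = ((e - b) * a) *: q + \sum_(i <- r | B i) (a * c i) *: G i.
Proof.
rewrite scalerDr scaler_sumr addrAC !scalerA -scalerBl [a * e]mulrC -mulrBl.
by congr (_ + _); apply: eq_bigr => i _; rewrite scalerA.
Qed.

Section Jack.
Variables (n : nat) (P : seq nat -> Lam n).
Hypothesis JP : jack_family P.

Lemma jack_ev_coef la m : la \in enum_part n -> (ev (P la))@_m != 0 ->
  (part_of_seq (mseq m) \in enum_part n) && dom_le (part_of_seq (mseq m)) la.
Proof.
move=> lan; have [c ->] := JP.1 la lan.
rewrite mcoeffD mcoeff_msymm raddf_sum /=.
have [-> _|_] := eqVneq (part_of_seq (mseq m)) la; first by rewrite lan dom_le_refl.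
rewrite add0r => H; apply: contraR H => H; apply/eqP.
rewrite big_seq_cond big1 // => mu /andP[mun /andP[ml _]]; rewrite mcoeffZ mcoeff_msymm.
case: eqP => [E|_]; last by rewrite mulr0.
by rewrite E mun ml in H.
Qed.

Lemma scal_q_jack_diag la : la \in enum_part n -> scal (qla n la) (P la) = 1.
Proof.
move=> lan; have [m pm] := part_of_seq_surj lan.
rewrite -[in qla n la]pm scal_qpart; have [c ->] := JP.1 la lan.
rewrite mcoeffD mcoeff_msymm pm eqxx raddf_sum /= big1 ?addr0 //.
move=> mu /andP[_ ml]; rewrite mcoeffZ mcoeff_msymm pm eq_sym.
by rewrite (negPf ml) mulr0.
Qed.

Lemma scal_q_jack_le mu la : mu \in enum_part n -> la \in enum_part n ->
  scal (qla n mu) (P la) != 0 -> dom_le mu la.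
Proof.
move=> mun lan; have [m <-] := part_of_seq_surj mun.
by rewrite scal_qpart => /(jack_ev_coef lan)/andP[].
Qed.

(** [jack_family] fixes the shape of [P la] only after evaluation; homogeneity in the power sums is
    recovered by injectivity of [ev]. *)
Lemma jack_pwhom la : la \in enum_part n -> pwhom n (P la).
Proof.
move=> lan; have <- : pwproj n (P la) = P la.
  apply: (@ev_inj n); apply/mpolyP => m.
  apply: etrans (mcoeff_ev_pwproj n (P la) m) _.
  case: eqP => // mn; apply/esym/eqP; apply: contraT => /(jack_ev_coef lan)/andP[+ _].
  by move/enum_part_sumn; rewrite (enum_part_sumn (part_of_seqP _)) sumn_mseq.
by move=> m; rewrite mcoeff_pwproj; have [//|_] := eqVneq (pweight m) n; rewrite eqxx.
Qed.

(* In other words f lies in the span of the P_eta with eta <= la; peeling off a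
   dominance-maximal eta at a time avoids constructing the expansion. *)
Lemma scal_lower_span la f g : la \in enum_part n -> pwhom n g ->
  (forall mu, mu \in enum_part n -> scal (qla n mu) f != 0 -> dom_le mu la) ->
  (forall et, et \in enum_part n -> dom_le et la -> scal g (P et) = 0) ->
  scal g f = 0.
Proof.
move=> lan gn.
suff H (S : seq (seq nat)) : {subset S <= enum_part n} ->
    (forall mu et, mu \in enum_part n -> et \in S -> dom_le mu et -> mu \in S) ->
    forall f, (forall mu, mu \in enum_part n -> scal (qla n mu) f != 0 -> mu \in S) ->
    (forall et, et \in S -> scal g (P et) = 0) -> scal g f = 0.
  move=> fla gP; apply: (H [seq et <- enum_part n | dom_le et la]).
  - by move=> et; rewrite mem_filter => /andP[].
  - move=> mu et mun; rewrite mem_filter [mu \in _]mem_filter mun andbT => /andP[el _] me.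
    exact: dom_le_trans el.
  - by move=> mu mun /(fla _ mun) ml; rewrite mem_filter ml mun.
  by move=> et; rewrite mem_filter => /andP[el en]; apply: gP.
have [N] := ubnP (size S); elim: N S => // N IH S SN Sn Sdown {}f fS gS.
(* Least [nsum] means dominance-maximal in [S]. *)
have [S0|/(exists_min nsum)[et eS emin]] := eqVneq S [::].
  apply: scal_kill gn _ => mu mun; apply/eqP; apply: contraT => /(fS _ mun).
  by rewrite S0.
have en := Sn _ eS.
pose f' := f - scal (qla n et) f *: P et.
suff E : scal g f' = 0.
  have -> : f = f' + scal (qla n et) f *: P et by rewrite subrK.
  by rewrite scalDr scalZr gS // mulr0 addr0.
apply: (IH [seq x <- S | x != et]).
- rewrite ltnS in SN; apply: leq_trans SN.
  rewrite size_filter -(count_predC (pred1 et)) -[X in (X < _)%N]add0n ltn_add2r.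
  by rewrite -has_count has_pred1.
- by move=> x; rewrite mem_filter => /andP[_ /Sn].
(* Removing a maximal element keeps the set closed downwards. *)
- move=> mu x mun; rewrite !mem_filter => /andP[xe xS] mx.
  rewrite (Sdown mu x) // andbT; apply/eqP => E; rewrite E in mx.
  have := nsum_lt en (Sn _ xS) mx; rewrite eq_sym => /(_ xe).
  by have := emin _ xS; lia.
- move=> mu mun; rewrite mem_filter /f'.
  have [->|me] := eqVneq mu et.
    by rewrite linearB /= scalZr scal_q_jack_diag // mulr1 subrr eqxx.
  move=> H /=; apply: contraR H => muS.
  have -> : f - scal (qla n et) f *: P et = f + (- scal (qla n et) f) *: P et.
    by rewrite scaleNr.
  rewrite scalDr scalZr.
  have -> : scal (qla n mu) f = 0.
    by apply/eqP; apply: contraR muS; apply: fS.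
  have -> : scal (qla n mu) (P et) = 0; last by rewrite mulr0 addr0.
  apply/eqP; apply: contraR muS => /(scal_q_jack_le mun en).
  exact: Sdown.
by move=> x; rewrite mem_filter => /andP[_ /gS].
Qed.

Lemma DL_jack_orth la ka : la \in enum_part n -> ka \in enum_part n ->
  dom_le la ka -> la != ka -> scal (P ka) (DL (P la)) = 0.
Proof.
move=> lan kan lk neq; apply: (scal_lower_span lan (jack_pwhom kan)).
  move=> mu mun; rewrite -DL_adj DL_qla_enum // scal_add_sum.
  move=> H; apply: contraR H => ml.
  have -> : scal (qla n mu) (P la) = 0.
    by apply/eqP; apply: contraR ml; apply: scal_q_jack_le.
  rewrite mulr0 add0r big_seq_cond big1 // => et /andP[en me].
  have -> : scal (qla n et) (P la) = 0; last by rewrite mulr0.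
  apply/eqP; apply: contraR ml => /(scal_q_jack_le en lan).
  exact: dom_le_trans (in_Mup_dom me).
move=> et en el; apply: JP.2 => //; apply: contra neq => /eqP E.
apply/eqP; apply: dom_le_anti lk _; rewrite ?E //.
- exact: enum_part_partition lan.
- exact: enum_part_partition en.
Qed.

Variables (la : seq nat) (C : seq nat -> F).
Hypothesis lan : la \in enum_part n.
Hypothesis QC : QJ P la = \sum_(mu <- enum_part n | dom_le la mu) C mu *: qla n mu.

(* The coefficient of q_mu in (D - e_la) Q_la. *)
Definition defect mu : F :=
  \sum_(nu <- enum_part n | in_Mup nu mu && dom_le la nu) C nu * r_coef nu mu
  + (eigen mu - eigen la) * C mu.

Lemma DL_QJ : DL (QJ P la) - eigen la *: QJ P la
  = \sum_(mu <- enum_part n | dom_le la mu) defect mu *: qla n mu.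
Proof.
rewrite QC linear_sum scaler_sumr /=.
transitivity (\sum_(mu <- enum_part n | dom_le la mu)
    (((eigen mu - eigen la) * C mu) *: qla n mu
     + \sum_(ka <- enum_part n | in_Mup mu ka) (C mu * r_coef mu ka) *: qla n ka)).
  rewrite -sumrB big_seq_cond [RHS]big_seq_cond; apply: eq_bigr => mu /andP[mun _].
  by rewrite DLZ DL_qla_enum //; apply: scale_add_sum.
rewrite big_split /= addrC (exchange_big_dep (dom_le la)) /=; last first.
  by move=> mu ka lm /in_Mup_dom; apply: dom_le_trans.
rewrite -big_split; apply: eq_bigr => mu lm /=.
rewrite /defect scalerDl scaler_suml; congr (_ + _).
by apply: eq_bigl => nu; rewrite andbC.
Qed.

Lemma defect0 mu : mu \in enum_part n -> dom_le la mu -> defect mu = 0.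
Proof.
move=> mun lm; apply/eqP; apply: contraT => dm.
pose S := [seq ka <- enum_part n | dom_le la ka && (defect ka != 0)].
have muS : mu \in S by rewrite mem_filter lm dm mun.
have S0 : S != [::] by apply/eqP => S0; rewrite S0 in muS.
(* Since [nsum] is at most $n^2$, minimising this difference maximises [nsum]: [ka] is
   dominance-minimal among the nonzero defects, and pairing with [P ka] isolates its defect. *)
have [ka] := exists_min (fun ka => n * n - nsum ka)%N S0.
rewrite mem_filter => /andP[/andP[lk dk] kan] kmin.
have E : scal (DL (QJ P la) - eigen la *: QJ P la) (P ka) = defect ka.
  rewrite DL_QJ scal_suml -big_filter.
  rewrite (bigD1_seq ka) /=; [|by rewrite mem_filter lk kan|by rewrite filter_uniq ?uniq_enum_part].
  rewrite scalZl scal_q_jack_diag // mulr1 big_filter_cond big_seq_cond big1 ?addr0 //.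
  move=> et /and3P[en le ek]; rewrite scalZl; apply/eqP; rewrite mulf_eq0.
  apply: contraT; rewrite negb_or => /andP[de /(scal_q_jack_le en kan) leek].
  have eS : et \in S by rewrite mem_filter le de en.
  have lt := nsum_lt en kan leek ek.
  have := kmin _ eS; rewrite leqNgt => /negP[].
  by rewrite ltn_sub2l // (leq_trans lt) // nsum_le.
case/eqP: dk.
(* At [la] itself orthogonality gives nothing, but the defect is an empty sum: a source of a move to
   [la] lies below [la], so one that is also above would be [la], which no move fixes. *)
have [kl|kl] := eqVneq ka la.
  rewrite kl /defect subrr mul0r addr0 big_seq_cond big1 // => nu /and3P[nun up ln].
  have pn := enum_part_partition nun; have pl := enum_part_partition lan.
  have /eqP := in_Mup_neq pn up; case.
  exact: dom_le_anti ln (in_Mup_dom up).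
rewrite -E /QJ DLZ; move: (_^-1) => c.
rewrite scalDl -scaleNr !scalZl.
rewrite [scal (DL _) _]scalC DL_jack_orth // 1?eq_sym // mulr0 add0r.
by rewrite JP.2 // 1?eq_sym // !mulr0.
Qed.
End Jack.

Theorem theorem5p10 (n : nat) (la : seq nat) (P : seq nat -> Lam n)
    (C : seq nat -> F) :
  is_part_of n la ->
  jack_family P ->
  QJ P la = \sum_(mu <- enum_part n | dom_le la mu) C mu *: qla n mu ->
  forall mu, mu \in enum_part n -> dom_lt la mu ->
    C mu = (\sum_(nu <- enum_part n | in_Mup nu mu && dom_le la nu)
               C nu * r_coef nu mu) / (eprime la - eprime mu).
Proof.
rewrite -mem_enum_part => lan JP QC mu mun lm.
have d0 := eprime_neq lan mun lm.
have := defect0 JP lan QC mun (proj1 (andP lm)).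
rewrite /defect !eigenE (enum_part_sumn lan) (enum_part_sumn mun).
move/eqP; rewrite addr_eq0 => /eqP ->.
rewrite -mulNr; apply/esym/(canLR (mulfK d0)).
by rewrite mulrC; congr (_ * _); ring.
Qed.
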